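(* Let $\mathcal S=\{1,\dots,N\}$ with $N>1$, let $d\ge 1$, and let $v_1,\dots,v_N\in\mathbb R^d$ be vectors, not all zero, with $d=\dim(\operatorname{span}\{v_1,\dots,v_N\})$. For $i\neq j$ let $a_{ij}:\mathbb R^d\to[0,\infty)$ be continuous functions. Let $(X,L)$ be the continuous-time Markov process on $\mathcal S\times\mathbb R^d$ with generator \[Af(j,l)=v_j\cdot\nabla_l f(j,l)+\sum_{i\neq j}a_{ji}(l)\,[f(i,l)-f(j,l)],\qquad j\in\mathcal S,\ l\in\mathbb R^d,\] i.e. $L(t)=L(0)+\sum_{j}v_j\,\mu(\{s\in[0,t]:X(s)=j\})$ ($\mu$ Lebesgue measure) and $X$ jumps from $i$ to $j$ at rate $a_{ij}(L(t))$. Assume $(X,L)$ is Harris irreducible. Let $p_1,\dots,p_N>0$ with $\sum_j p_j=1$ and let $g:\mathbb R^d\to[0,\infty)$ be a differentiable function with $\int_{\mathbb R^d}g(l)\,dl=1$. Then the probability measure $p_j\,g(l)\,dj\,dl$ on $\mathcal S\times\mathbb R^d$ (counting measure in $j$, Lebesgue measure in $l$) is invariant for $(X,L)$ if and only if \[-p_j v_j\cdot\nabla g(l)+\sum_{i\neq j}\big[p_i a_{ij}(l)g(l)-p_j a_{ji}(l)g(l)\big]=0\qquad\text{for all } j=1,\dots,N,\ l\in\mathbb R^d.\]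
   Context: Harris irreducibility means: there exist an open set $U\subset\mathbb R^d$ and $j_0\in\mathcal S$ such that for every starting point $(x,l)\in\mathcal S\times\mathbb R^d$ there is $t>0$ with $P((X(t),L(t))\in\{j_0\}\times U)>0$. *)

(* Defs.v *)
From HB Require Import structures.
From mathcomp Require Import all_boot all_order all_algebra.
From mathcomp Require Import all_classical all_reals all_analysis.
From mathcomp Require Import measurable_realfun lebesgue_measure.
Import numFieldNormedType.Exports.
Import Order.TTheory GRing.Theory Num.Theory.

Set Implicit Arguments.
Unset Strict Implicit.
Unset Printing Implicit Defensive.

Local Open Scope classical_set_scope.
Local Open Scope ring_scope.

(* R^d is 'rV[R]_d (normed topology, derivatives).  [Rd R d] is the same
   carrier equipped with its Borel sigma-algebra (generated by open sets). *)
Definition Rd (R : realType) (d : nat) : Type := 'rV[R]_d.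

Section Rd_instances.
Variables (R : realType) (d : nat).
HB.instance Definition _ := Pointed.on (Rd R d).
HB.instance Definition _ :=
  @isMeasurable.Build (sigma_display (@open 'rV[R]_d)) (Rd R d)
  <<s (@open 'rV[R]_d) >> (@sigma_algebra0 _ setT _) (@sigma_algebraC _ _)
  (@sigma_algebra_bigcup _ setT _).
End Rd_instances.

(* Lebesgue integral over R^d of a nonnegative function, computed as the
   iterated one-dimensional Lebesgue integral (= the d-dimensional Lebesgue
   integral for nonnegative measurable integrands, by Tonelli). *)
Fixpoint leb_int (R : realType) (n : nat) : ('rV[R]_n -> \bar R) -> \bar R :=
  match n return ('rV[R]_n -> \bar R) -> \bar R with
  | 0 => fun F => F 0
  | n'.+1 => fun F => (\int[@lebesgue_measure R]_(x in setT)
        @leb_int R n' (fun y => F (row_mx (const_mx x : 'rV[R]_1) y)))%E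
  end.

(* A transition function of the process on S x R^d, S = 'I_N:
   P t j l i is the (sub-)measure B |-> P((X(t),L(t)) in {i} x B | (X(0),L(0)) = (j,l)). *)
Definition trans_fun (R : realType) (N d : nat) :=
  R -> 'I_N -> 'rV[R]_d -> 'I_N -> {measure set (Rd R d) -> \bar R}.

Definition test_fun (R : realType) (N d : nat) (f : 'I_N -> 'rV[R]_d -> R) : Prop :=
  forall j, (forall l, differentiable (f j) l) /\
            (forall w : 'rV[R]_d, continuous ('D_w (f j))) /\
            (exists M : R, forall l, M < `|l| -> f j l = 0).

Definition generator (R : realType) (N d : nat) (v : 'I_N -> 'rV[R]_d)
  (a : 'I_N -> 'I_N -> 'rV[R]_d -> R) (f : 'I_N -> 'rV[R]_d -> R)
  (j : 'I_N) (l : 'rV[R]_d) : R :=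
  'D_(v j) (f j) l + \sum_(i < N | i != j) a j i l * (f i l - f j l).

Definition kint (R : realType) (d : nat) (mu : {measure set (Rd R d) -> \bar R})
  (h : 'rV[R]_d -> R) : \bar R :=
  (\int[mu]_(y in setT) (h (y : 'rV[R]_d))%:E)%E.

(* P is the transition function of the Markov process (X,L) with generator A:
   a measurable Markov semigroup of kernels, starting at the identity, and
   satisfying Dynkin's formula  P_t f = f + int_0^t P_s (A f) ds  for every
   test function f. *)
Definition is_process_semigroup (R : realType) (N d : nat)
  (v : 'I_N -> 'rV[R]_d) (a : 'I_N -> 'I_N -> 'rV[R]_d -> R)
  (P : trans_fun R N d) : Prop :=
  [/\ (forall j l i (B : set (Rd R d)), measurable B ->
         P 0 j l i B = (if i == j then (\1_B l)%:E else 0%E)),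
      (forall t j l, 0 <= t -> (\sum_(i < N) P t j l i setT = 1)%E),
      (forall t j i (B : set (Rd R d)), 0 <= t -> measurable B ->
         measurable_fun setT (fun l : Rd R d => P t j l i B)),
      (forall s t j l i (B : set (Rd R d)), 0 <= s -> 0 <= t -> measurable B ->
         P (s + t) j l i B =
         (\sum_(k < N) \int[P s j l k]_(y in setT) P t k y i B)%E) &
      (forall f, test_fun f -> forall t j l, 0 <= t ->
         (\sum_(i < N) kint (P t j l i) (f i) =
          (f j l)%:E + \int[@lebesgue_measure R]_(s in [set s : R | (0 <= s <= t)%R])
             \sum_(i < N) kint (P s j l i) (generator v a f i))%E)].

Definition harris_irreducible (R : realType) (N d : nat) (P : trans_fun R N d) : Prop :=
  exists (U : set 'rV[R]_d) (j0 : 'I_N), open U /\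
    forall j l, exists t : R, 0 < t /\ (0 < P t j l j0 U)%E.

(* The measure pi(dj,dl) = h(j,l) dj dl (h a density w.r.t. counting x Lebesgue)
   is invariant:  pi P_t = pi  for all t >= 0 (tested on the generating sets
   {i} x B, B Borel). *)
Definition invariant_density (R : realType) (N d : nat) (P : trans_fun R N d)
  (h : 'I_N -> 'rV[R]_d -> R) : Prop :=
  forall t, 0 <= t -> forall i (B : set (Rd R d)), measurable B ->
    (\sum_(j < N) leb_int (fun l => (h j l)%:E * P t j l i B) =
     leb_int (fun l => (h i l)%:E * (\1_B l)%:E))%E.

(* Main.v *)
(* Let pi be the measure with density p_j g(l) and let T_u f (j, l) = f (j, l + u v_j)
   be the free transport.  Invariance is compared with the weak equation
   pi (A f) = 0 for all C^1 test functions f, and the latter with the PDE.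

   Test functions are uniformly dense among the continuous functions h with
   compact support, so Dynkin's formula gives |P_s h - h| -> 0 uniformly, and
   then P_s f = f + s A f + o(s) uniformly; integrating against pi shows that
   invariance implies the weak equation. Conversely the signed measure w_s = pi
   P_s - pi satisfies d/ds w_s (T_(t-s) f) = w_s (J T_(t-s) f), where J is the
   jump part of A, because the transport parts cancel. Since J is bounded on
   bounded sets and T moves supports at bounded speed, a Gronwall iteration on
   the shrinking balls of radius rho + V (t - s) forces w_t (f) = 0. The rates
   being merely continuous, J f need not be C^1 and is approximated by test
   functions.

   The weak equation follows from the PDE because the integral of a directional
   derivative vanishes (translation invariance).  For the converse g is only
   differentiable, so integrating by parts is not available; instead
   s |-> int g(l) phi(l - s w) dl is differentiated and phi is concentrated at a
   point. *)
From HB Require Import structures.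
Require Import Defs.
From mathcomp Require Import all_boot all_order all_algebra.
From mathcomp Require Import all_classical all_reals all_analysis.
From mathcomp Require Import measurable_realfun lebesgue_measure.
From mathcomp Require Import ring lra.
Import numFieldNormedType.Exports.
Import Order.TTheory GRing.Theory Num.Theory.
Local Open Scope classical_set_scope.
Local Open Scope ring_scope.

Set Implicit Arguments.
Unset Strict Implicit.
Unset Printing Implicit Defensive.

(** * Functions of class C^1 on R^d *)

(** Free transport serves as comparison flow because it merely translates each component by a
    multiple of [v j]: it maps test functions to test functions exactly, and comparing with it
    leaves only the zero order operator [J]. The radius [rho + V t] is fixed before the iteration
    because the rates may be unbounded: no support occurring up to time [t] leaves that ball, so a
    single bound on the rates serves all ranks. In time, neither measurability of [s |-> P_s (A f)]
    nor two-sided derivatives are at hand. Time integrals are therefore sandwiched between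
    constants, and both comparison arguments run on right slopes. The integral of the statement is
    an iterated one; a measure on R^d representing it is constructed once and then used through its
    values on balls and its translation invariance. *)

Section continuous_pointwise.
Variables (R : realType) (T : topologicalType).
Implicit Types f h : T -> R.

Lemma ctsD f h : continuous f -> continuous h -> continuous (fun x => f x + h x).
Proof. by move=> cf ch x; exact: (continuousD (cf x) (ch x)). Qed.

Lemma ctsB f h : continuous f -> continuous h -> continuous (fun x => f x - h x).
Proof. by move=> cf ch x; exact: (continuousB (cf x) (ch x)). Qed.

Lemma ctsN f : continuous f -> continuous (fun x => - f x).
Proof. by move=> cf x; exact: (continuousN (cf x)). Qed.

Lemma ctsM f h : continuous f -> continuous h -> continuous (fun x => f x * h x).
Proof. by move=> cf ch x; exact: (continuousM (cf x) (ch x)). Qed.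

Lemma ctsV f : (forall x, f x != 0) -> continuous f -> continuous (fun x => (f x)^-1).
Proof. by move=> f0 cf x; exact: (continuousV (f0 x) (cf x)). Qed.

Lemma cts_sum (I : Type) (r : seq I) (Q : pred I) (F : I -> T -> R) :
  (forall i, Q i -> continuous (F i)) ->
  continuous (fun x => \sum_(i <- r | Q i) F i x).
Proof.
move=> CF; elim: r => [|i r IH].
  by under eq_fun do rewrite big_nil; exact: cst_continuous.
under eq_fun do rewrite big_cons.
by case: (boolP (Q i)) => // Qi; apply: ctsD => //; exact: CF.
Qed.

End continuous_pointwise.

Definition C1 (R : realType) (d : nat) (f : 'rV[R]_d -> R) : Prop :=
  (forall l, differentiable f l) /\ forall w, continuous ('D_w f).

Section C1_theory.
Variables (R : realType) (d : nat).
Implicit Types (f h : 'rV[R]_d -> R) (l w : 'rV[R]_d).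

Lemma C1_continuous f : C1 f -> continuous f.
Proof. by move=> [df _] l; exact: differentiable_continuous. Qed.

Lemma C1_derivable f l w : C1 f -> derivable f l w.
Proof. by move=> [df _]; exact: diff_derivable. Qed.

Lemma C1_cst (c : R) : C1 (fun _ : 'rV[R]_d => c).
Proof.
split=> [l|w]; first exact: differentiable_cst.
rewrite (_ : 'D_w _ = fun=> 0); first exact: cst_continuous.
by apply/funext => l; rewrite derive_cst.
Qed.

Lemma C1_coord (k : 'I_d) : C1 (fun l => l 0 k).
Proof.
split=> [l|w]; first exact: differentiable_coord.
rewrite (_ : 'D_w _ = fun=> w 0 k); first exact: cst_continuous.
apply/funext => l; rewrite deriveE; last exact: differentiable_coord.
pose g := fun l : 'rV[R]_d => l 0 k.
have lg : linear g by move=> a x y; rewrite /g !mxE.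
pose gL := HB.pack g (GRing.isLinear.Build _ _ _ _ g lg) : {linear 'rV[R]_d -> R}.
rewrite (_ : (fun l => _) = gL)// diff_lin//.
exact: coord_continuous.
Qed.

Lemma C1D f h : C1 f -> C1 h -> C1 (fun l => f l + h l).
Proof.
move=> [df cf] [dh ch]; split=> [l|w]; first exact: differentiableD.
rewrite (_ : 'D_w _ = fun l => 'D_w f l + 'D_w h l); last first.
  by apply/funext => l; rewrite deriveD//; exact: diff_derivable.
exact: ctsD.
Qed.

Lemma C1M f h : C1 f -> C1 h -> C1 (fun l => f l * h l).
Proof.
move=> Cf Ch; have [df cf] := Cf; have [dh ch] := Ch.
split=> [l|w]; first exact: differentiableM.
rewrite (_ : 'D_w _ = fun l => f l * 'D_w h l + h l * 'D_w f l); last first.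
  by apply/funext => l; rewrite deriveM//; exact: diff_derivable.
by apply: ctsD; apply: ctsM => //; exact: C1_continuous.
Qed.

Lemma C1Z (c : R) f : C1 f -> C1 (fun l => c * f l).
Proof. by move=> Cf; exact: (C1M (C1_cst c) Cf). Qed.

Lemma C1B f h : C1 f -> C1 h -> C1 (fun l => f l - h l).
Proof.
move=> Cf Ch; rewrite (_ : (fun l => _) = fun l => f l + (-1) * h l).
  exact: (C1D Cf (C1Z _ Ch)).
by apply/funext => l; rewrite mulN1r.
Qed.

Lemma C1V f : (forall l, f l != 0) -> C1 f -> C1 (fun l => (f l)^-1).
Proof.
move=> f0 Cf; have [df cf] := Cf; split=> [l|w]; first exact: differentiableV.
rewrite (_ : 'D_w _ = fun l => - (f l) ^- 2 *: 'D_w f l); last first.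
  by apply/funext => l; rewrite deriveV//; exact: diff_derivable.
apply: ctsM => //; apply: ctsN; apply: ctsV => [l|]; first by rewrite expf_neq0.
by apply: ctsM; exact: C1_continuous.
Qed.

Lemma C1_sum (I : Type) (r : seq I) (Q : pred I) (F : I -> 'rV[R]_d -> R) :
  (forall i, Q i -> C1 (F i)) -> C1 (fun l => \sum_(i <- r | Q i) F i l).
Proof.
move=> CF; elim: r => [|i r IH].
  by under eq_fun do rewrite big_nil; exact: C1_cst.
under eq_fun do rewrite big_cons.
by case: (boolP (Q i)) => [Qi|_]; [exact: (C1D (CF _ Qi) IH)|exact: IH].
Qed.

Lemma C1_prod (I : Type) (r : seq I) (Q : pred I) (F : I -> 'rV[R]_d -> R) :
  (forall i, Q i -> C1 (F i)) -> C1 (fun l => \prod_(i <- r | Q i) F i l).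
Proof.
move=> CF; elim: r => [|i r IH].
  by under eq_fun do rewrite big_nil; exact: C1_cst.
under eq_fun do rewrite big_cons.
by case: (boolP (Q i)) => [Qi|_]; [exact: (C1M (CF _ Qi) IH)|exact: IH].
Qed.

Lemma C1X f n : C1 f -> C1 (fun l => f l ^+ n).
Proof.
move=> Cf; elim: n => [|n IH]; first exact: C1_cst.
by under eq_fun do rewrite exprS; exact: C1M.
Qed.

Lemma derive_shift_arg f w (u : 'rV[R]_d) l :
  'D_w (fun x => f (x + u)) l = 'D_w f (l + u).
Proof.
have E : (fun h : R => h^-1 *: (((fun x => f (x + u)) \o shift l) (h *: w) - f (l + u)))
    = (fun h : R => h^-1 *: ((f \o shift (l + u)) (h *: w) - f (l + u))).
  by apply/funext => h /=; rewrite addrA.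
by rewrite /derive E.
Qed.

Lemma continuous_shift_arg (h : 'rV[R]_d -> R) (u : 'rV[R]_d) :
  continuous h -> continuous (fun x : 'rV[R]_d => h (x + u)).
Proof.
move=> ch l; apply: (@continuous_comp _ _ _ (fun x : 'rV[R]_d => x + u) h); last exact: ch.
apply: (@continuousD _ _ _ id (cst u) l); [exact: cvg_id|exact: cst_continuous].
Qed.

Lemma C1_shift f (u : 'rV[R]_d) : C1 f -> C1 (fun l => f (l + u)).
Proof.
move=> [df cf]; split=> [l|w].
  apply: (@differentiable_comp _ _ _ _ (fun x : 'rV[R]_d => x + u) f); last exact: df.
  by apply: differentiableD; [exact: ex_diff|exact: differentiable_cst].
rewrite (_ : 'D_w _ = fun l => 'D_w f (l + u)); last first.
  by apply/funext => l; rewrite derive_shift_arg.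
exact: (continuous_shift_arg (cf w)).
Qed.

End C1_theory.

(** * C^1 bump functions and approximation by C^1 functions *)

Definition sqr_pos (R : realType) (x : R) : R := Num.max 0 x ^+ 2.

Section sqr_pos_theory.
Variable R : realType.

Lemma sqr_pos_ge0 (x : R) : 0 <= sqr_pos x.
Proof. exact: sqr_ge0. Qed.

Lemma sqr_pos_le0 (x : R) : x <= 0 -> sqr_pos x = 0.
Proof. by move=> x0; rewrite /sqr_pos max_l// expr0n. Qed.

Lemma sqr_pos_gt0 (x : R) : (0 < sqr_pos x) = (0 < x).
Proof.
case: (ltP 0 x) => x0; last by rewrite sqr_pos_le0// ltxx.
by rewrite /sqr_pos max_r ?exprn_gt0// ltW.
Qed.

Lemma is_derive_sqr_pos (x : R) : is_derive x 1 (@sqr_pos R) (2 * Num.max 0 x).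
Proof.
suff H : h^-1 *: ((@sqr_pos R \o shift x) (h *: 1) - sqr_pos x) @[h --> 0^']
    --> 2 * Num.max 0 x.
  by apply: DeriveDef; [exact: cvgP H|exact: cvg_lim H].
apply/cvgrPdist_le => /= e e0; near=> h.
have h0 : h != 0 by near: h; exact: nbhs_dnbhs_neq.
have he : `|h| <= e by near: h; apply: dnbhs0_le.
(* After multiplication by the modulus of [h], it remains to bound the first order remainder of
   [sqr_pos] by [h ^+ 2], which is checked on the signs of [x] and [h + x]. *)
rewrite -[leLHS]mulr1 -[X in _ * X](@mulfV _ `|h|) ?normr_eq0//.
rewrite mulrA -normrM ler_pdivrMr ?normr_gt0//.
apply: (@le_trans _ _ (`|h| * `|h|)); last first.
  by apply: ler_wpM2r.
rewrite [h%:A]mulr1 -[h^-1 *: _]/(h^-1 * _) mulrBl [_ * h]mulrC mulrAC mulVf// mul1r.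
rewrite -normrM -expr2 [leRHS]ger0_norm ?sqr_ge0// /sqr_pos.
have [x0|x0] := leP 0 x; have [xh0|xh0] := leP 0 (h + x);
  rewrite ler_norml; apply/andP; split; nra.
Unshelve. all: by end_near. Qed.

Lemma C1_sqr_pos d (f : 'rV[R]_d -> R) : C1 f -> C1 (fun l => sqr_pos (f l)).
Proof.
move=> Cf; have [df cf] := Cf.
have ds (x : R) : differentiable (@sqr_pos R) x.
  apply/derivable1_diffP.
  by have [] := is_derive_sqr_pos x.
have dc l : differentiable (fun l => sqr_pos (f l)) l.
  exact: differentiable_comp.
split=> // w.
rewrite (_ : 'D_w _ = fun l => 'D_w f l * (2 * Num.max 0 (f l))); last first.
  apply/funext => l; rewrite deriveE// (_ : (fun l => _) = @sqr_pos R \o f)//.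
  rewrite diff_comp//= diff1E// derive1E -(deriveE _ (df l)).
  by have [_ ->] := is_derive_sqr_pos (f l).
apply: ctsM => //; apply: ctsM; first exact: cst_continuous.
move=> l; apply: (@continuous_max _ _ (cst 0) f); first exact: cst_continuous.
exact: C1_continuous.
Qed.

End sqr_pos_theory.
Section bumps.
Variables (R : realType) (d : nat).
Implicit Types (f h : 'rV[R]_d -> R) (l q w : 'rV[R]_d).

Lemma row_norm_leP l (r : R) : 0 <= r ->
  (forall k, `|l 0 k| <= r) <-> `|l| <= r.
Proof.
move=> r0; rewrite [`|l|]/Num.norm/= mx_normrE; split=> [H|H k].
  by apply/bigmax_leP; split=> // -[i k] _ /=; rewrite ord1.
apply: le_trans H; apply: (@le_bigmax _ _ _ 0 (fun ij => `|l ij.1 ij.2|) (0, k)).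
Qed.

Lemma row_norm_ltP l (r : R) : 0 < r ->
  (forall k, `|l 0 k| < r) <-> `|l| < r.
Proof.
move=> r0; rewrite [`|l|]/Num.norm/= mx_normrE; split=> [H|H k].
  by apply/bigmax_ltP; split=> // -[i k] _ /=; rewrite ord1.
apply: le_lt_trans H; apply: (@le_bigmax _ _ _ 0 (fun ij => `|l ij.1 ij.2|) (0, k)).
Qed.

(** The norm of ['rV[R]_d] is the sup norm, so a product of one-dimensional bumps is positive
    exactly on the open ball of radius [r]. *)
Definition bump q (r : R) l : R :=
  \prod_(k < d) sqr_pos (r ^+ 2 - (l 0 k - q 0 k) ^+ 2).

Lemma bump_ge0 q r l : 0 <= bump q r l.
Proof. by apply: prodr_ge0 => k _; exact: sqr_pos_ge0. Qed.

Lemma bump_gt0 q r l : 0 < r -> (0 < bump q r l) = (`|l - q| < r).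
Proof.
move=> r0; have E k : (0 < sqr_pos (r ^+ 2 - (l 0 k - q 0 k) ^+ 2)) =
    (`|(l - q) 0 k| < r).
  rewrite sqr_pos_gt0 subr_gt0 !mxE -[X in X < _]real_normK ?num_real//.
  by rewrite ltr_pXn2r// nnegrE ltW.
apply/idP/idP => [b0|/row_norm_ltP - /(_ r0) H]; last first.
  by apply: prodr_gt0 => k _; rewrite E.
apply/row_norm_ltP => // k; rewrite -E lt_neqAle sqr_pos_ge0 andbT eq_sym.
by apply: contraTneq b0 => e0; rewrite /bump (bigD1 k)//= e0 mul0r ltxx.
Qed.

Lemma bump_eq0 q r l : 0 < r -> r <= `|l - q| -> bump q r l = 0.
Proof.
move=> r0 rl; apply/eqP; rewrite eq_le bump_ge0 andbT leNgt bump_gt0//.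
by rewrite -leNgt.
Qed.

Lemma C1_bump q r : C1 (bump q r).
Proof.
apply: C1_prod => k _; apply: C1_sqr_pos; apply: C1B; first exact: C1_cst.
by apply: C1X; apply: C1B; [exact: C1_coord|exact: C1_cst].
Qed.

Definition outer_bump (r : R) l : R := \sum_(k < d) sqr_pos (l 0 k ^+ 2 - r ^+ 2).

Lemma outer_bump_ge0 r l : 0 <= outer_bump r l.
Proof. by apply: sumr_ge0 => k _; exact: sqr_pos_ge0. Qed.

Lemma outer_bump_eq0 r l : 0 <= r -> `|l| <= r -> outer_bump r l = 0.
Proof.
move=> r0 /row_norm_leP - /(_ r0) lr; apply: big1 => k _; apply: sqr_pos_le0.
rewrite subr_le0 -[X in X <= _]real_normK ?num_real//.
by rewrite lerXn2r// nnegrE.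
Qed.

Lemma outer_bump_gt0 r l : 0 <= r -> r < `|l| -> 0 < outer_bump r l.
Proof.
move=> r0 rl; rewrite lt_neqAle outer_bump_ge0 andbT eq_sym.
apply: contraTN rl; rewrite psumr_eq0; last by move=> k _; exact: sqr_pos_ge0.
move=> /allP H; rewrite -leNgt; apply/row_norm_leP => // k.
have /H/= /eqP E : k \in index_enum 'I_d by rewrite mem_index_enum.
rewrite -ler_sqr ?nnegrE// real_normK ?num_real//.
by rewrite leNgt -subr_gt0 -sqr_pos_gt0 E ltxx.
Qed.

Lemma C1_outer_bump r : C1 (outer_bump r).
Proof.
apply: C1_sum => k _; apply: C1_sqr_pos; apply: C1B; last exact: C1_cst.
by apply: C1X; exact: C1_coord.
Qed.

Lemma compact_closed_ball_rV (r : R) : compact [set l : 'rV[R]_d | `|l| <= r].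
Proof.
apply: bounded_closed_compact.
  exists r; split; first exact: num_real.
  by move=> M rM l /= /le_trans; apply; exact: ltW.
apply: (preimage_closed (f := fun l : 'rV[R]_d => `|l|) (D := [set x : R | x <= r])).
  by move=> l _; exact: norm_continuous.
exact: closed_le.
Qed.

(* Shepard interpolation: [sum_q h(q) b_q / (sum_q b_q + c)], where the bumps
   [b_q] cover the ball and [c] vanishes on it while keeping the denominator
   positive elsewhere. *)
Lemma C1_approx h (rho e : R) : continuous h -> 0 < e ->
  exists k, [/\ C1 k, forall l, `|l| <= rho -> `|k l - h l| <= e &
    forall l, (forall q, `|q - l| < 1 -> h q = 0) -> k l = 0].
Proof.
move=> ch e0; set r1 := `|rho|.
have H q : exists r : R, [/\ 0 < r, r <= 1 & forall l, `|l - q| < r -> `|h l - h q| <= e].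
  have /cvgrPdist_le/(_ e e0)/nbhs_ballP[r /= r0 Hr] := ch q.
  (* Radii at most 1 confine the support of the interpolant to the 1-neighbourhood of the support of
     [h]. *)
  exists (Num.min r 1); split; first by rewrite lt_min r0 ltr01.
    by rewrite ge_min lexx orbT.
  move=> l; rewrite lt_min => /andP[lr _]; rewrite distrC; apply: Hr.
  by rewrite -ball_normE /ball_/= distrC.
have {H}[r Hr] := choice H.
have r0 q : 0 < r q by have [] := Hr q.
have := @compact_closed_ball_rV r1; rewrite compact_cover => /(_ _ setT (fun q => ball q (r q))).
case=> [q _|l _|D _ Dcov]; first exact: ball_open.
  by exists l => //; exact: ballxx.
pose E : seq 'rV[R]_d := finmap.enum_fset D.
pose S l := \sum_(q <- E) bump q (r q) l + outer_bump r1 l.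
have S0 l : 0 < S l.
  rewrite /S; have [lr|lr] := leP `|l| r1; last first.
    apply: ltr_wpDl; last by apply: outer_bump_gt0 lr; exact: normr_ge0.
    by apply: sumr_ge0 => q _; exact: bump_ge0.
  apply: ltr_wpDr; first exact: outer_bump_ge0.
  have [q /= qD lq] := Dcov _ lr.
  rewrite (big_rem q)//=; apply: ltr_wpDr.
    by apply: sumr_ge0 => q' _; exact: bump_ge0.
  by rewrite bump_gt0//; move: lq; rewrite -ball_normE /ball_/= distrC.
exists (fun l => (\sum_(q <- E) h q * bump q (r q) l) * (S l)^-1); split.
- apply: C1M; first by apply: C1_sum => q _; apply: C1Z; exact: C1_bump.
  apply: C1V => [l|]; first by rewrite gt_eqF.
  apply: C1D; last exact: C1_outer_bump.
  by apply: C1_sum => q _; exact: C1_bump.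
- move=> l lrho; have Sl : S l = \sum_(q <- E) bump q (r q) l.
    rewrite /S outer_bump_eq0 ?addr0//; first exact: normr_ge0.
    exact: le_trans lrho (ler_norm _).
  (* Over the common denominator, the error is a weighted average of the differences [h q - h l], in
     which only centres [q] closer to [l] than [r q] carry weight. *)
  rewrite -[X in _ - X](@mulfK _ (S l)) ?gt_eqF// -mulrBl normrM normfV.
  rewrite (gtr0_norm (S0 l)) ler_pdivrMr// Sl !mulr_sumr -sumrB.
  apply: le_trans (ler_norm_sum _ _ _) _; apply: ler_sum => q _.
  rewrite -mulrBl normrM (ger0_norm (bump_ge0 _ _ _)).
  have [lq|lq] := ltP `|l - q| (r q); last by rewrite bump_eq0 ?mulr0.
  rewrite ler_wpM2r ?bump_ge0// distrC.
  by have [_ _] := Hr q; apply.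
- move=> l H; rewrite big1 ?mul0r// => q _.
  have [lq|lq] := ltP `|l - q| (r q); last by rewrite bump_eq0 ?mulr0.
  rewrite H ?mul0r// distrC; apply: lt_le_trans lq _.
  by have [] := Hr q.
Qed.

End bumps.

(** * Uniform estimates for functions of compact support *)

Section compact_support.
Variables (R : realType) (d : nat).
Implicit Types (f h : 'rV[R]_d -> R) (l w : 'rV[R]_d).

Lemma continuous_ball_bounded h (M : R) : continuous h ->
  exists2 B, 0 <= B & forall l, `|l| <= M -> `|h l| <= B.
Proof.
move=> ch; have := @compact_closed_ball_rV R d M.
move=> /compact_near_coveringP/(_ R +oo (fun B l => `|h l| <= B)) H.
have {}H : \forall B \near +oo, [set l | `|l| <= M] `<=` (fun l => `|h l| <= B).
  apply: H => l _; have /cvgrPdist_lt/(_ 1 ltr01) cl := ch l.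
  exists ([set x | `|h l - h x| < 1], [set B | `|h l| + 1 <= B]).
    split=> //=; apply: nbhs_pinfty_ge; exact: num_real.
  move=> [x B] /= [xl lB]; apply: le_trans lB.
  rewrite -[h x](subrKC (h l)); apply: le_trans (ler_normD _ _) _.
  by rewrite lerD2l distrC ltW.
near +oo_R => B; exists B; first by near: B; apply: nbhs_pinfty_ge; exact: num_real.
move=> l lM.
have : [set l | `|l| <= M] `<=` (fun l => `|h l| <= B) by near: B.
by apply.
Unshelve. all: by end_near. Qed.

Lemma supp_bounded h (M : R) : continuous h -> (forall l, M < `|l| -> h l = 0) ->
  exists2 B, 0 <= B & forall l, `|h l| <= B.
Proof.
move=> ch hM; have [B B0 hB] := continuous_ball_bounded M ch; exists B => // l.
by have [/hB//|/hM->] := leP `|l| M; rewrite normr0.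
Qed.

Lemma supp_unif_continuous h (M e : R) : continuous h ->
  (forall l, M < `|l| -> h l = 0) -> 0 < e ->
  exists2 eta, 0 < eta & forall x y, `|x - y| < eta -> `|h x - h y| <= e.
Proof.
move=> ch hM e0; have := @compact_closed_ball_rV R d M.
move=> /compact_near_coveringP/(_ R 0^'+
  (fun eta x => forall y, `|x - y| < eta -> `|h x - h y| <= e)) H.
have {}H : \forall eta \near 0^'+, [set l | `|l| <= M] `<=`
    (fun x => forall y, `|x - y| < eta -> `|h x - h y| <= e).
  apply: H => l _; have e20 : 0 < e / 2 by rewrite divr_gt0.
  have /cvgrPdist_le/(_ (e / 2) e20)/nbhs_ballP[r /= r0 Hr] := ch l.
  exists (ball l (r / 2), [set eta | eta < r / 2]).
    split=> /=; first by apply: nbhsx_ballx; rewrite divr_gt0.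
    by apply: nbhs_right_lt; rewrite divr_gt0.
  move=> [x eta] /= [lx er] y xy; move: lx; rewrite -ball_normE /= => lx.
  have /Hr hx : ball l r x.
    by rewrite -ball_normE /=; apply: lt_trans lx _; rewrite ltr_pdivrMr// ltr_pMr// ltr1n.
  have /Hr hy : ball l r y.
    rewrite -ball_normE /= -(subrKA x); apply: le_lt_trans (ler_normD _ _) _.
    by rewrite [r]splitr ltrD// (lt_trans xy).
  rewrite -(subrKA (h l)); apply: le_trans (ler_normD _ _) _.
  by rewrite [e]splitr lerD// distrC.
near (0 : R)^'+ => eta; exists eta; first by near: eta; exact: nbhs_right_gt.
move=> x y xy.
have H1 : [set l | `|l| <= M] `<=`
    (fun x => forall y, `|x - y| < eta -> `|h x - h y| <= e) by near: eta.
have [xM|xM] := leP `|x| M; first exact: H1.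
have [yM|yM] := leP `|y| M; first by rewrite distrC; apply: H1 => //; rewrite distrC.
by rewrite !hM// subrr normr0 ltW.
Unshelve. all: by end_near. Qed.

Lemma is_derive_line f w l (s : R) : derivable f (l + s *: w) w ->
  is_derive s 1 (fun s : R => f (l + s *: w)) ('D_w f (l + s *: w)).
Proof.
move=> df.
have E : (fun h : R => h^-1 *: (((fun s => f (l + s *: w)) \o shift s) (h *: 1)
      - f (l + s *: w)))
    = (fun h : R => h^-1 *: ((f \o shift (l + s *: w)) (h *: w) - f (l + s *: w))).
  apply/funext => h /=; congr (_ *: (f _ - _)).
  by rewrite scalerDl [h%:A]mulr1 addrCA.
by apply: DeriveDef; rewrite /derivable /derive E.
Qed.

Lemma mean_value_dir f w l (s : R) : (forall x, derivable f x w) ->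
  exists2 c, `|c| <= `|s| & f (l + s *: w) - f l = s * 'D_w f (l + c *: w).
Proof.
move=> df; pose F := fun s : R => f (l + s *: w).
have dF (c : R) : is_derive c 1 F ('D_w f (l + c *: w)) by exact: is_derive_line.
have cF (A : set R) : {within A, continuous F}.
  apply: continuous_subspaceT => c; apply/differentiable_continuous/derivable1_diffP.
  by have [] := dF c.
have f0 : f l = F 0 by rewrite /F scale0r addr0.
have [s0|s0] := leP 0 s.
  have [c] := MVT_segment s0 (fun c _ => dF c) (cF _).
  rewrite in_itv/= => /andP[c0 cs] E; exists c; first by rewrite !ger0_norm.
  by rewrite f0 -[f _]/(F s) E subr0 mulrC.
have [c] := MVT_segment (ltW s0) (fun c _ => dF c) (cF _).
rewrite in_itv/= => /andP[sc c0] E; exists c.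
  by rewrite !ler0_norm ?lerN2// ltW.
by rewrite f0 -[f _]/(F s) -opprB E sub0r mulrN opprK mulrC.
Qed.

Lemma derive_supp f w (M : R) : (forall l, M < `|l| -> f l = 0) ->
  forall l, M < `|l| -> 'D_w f l = 0.
Proof.
move=> fM l lM; rewrite (@near_eq_derive _ _ _ _ (cst 0))//.
  by rewrite derive_cst.
near=> x; apply: fM; near: x.
have /cvgrPdist_lt/(_ (`|l| - M)) := @norm_continuous _ 'rV[R]_d l.
rewrite subr_gt0 => /(_ lM); apply: filterS => x.
by move=> /= /(le_lt_trans (ler_norm _)); lra.
Unshelve. all: by end_near. Qed.

(** By the mean value theorem the remainder is [s] times a difference of two values of ['D_w f], and
    ['D_w f] is uniformly continuous because it is continuous with compact support. *)
Lemma unif_taylor f w (M e : R) : (forall l, derivable f l w) ->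
  continuous ('D_w f) -> (forall l, M < `|l| -> f l = 0) -> 0 < e ->
  exists2 eta, 0 < eta & forall s l, `|s| < eta ->
    `|f (l + s *: w) - f l - s * 'D_w f l| <= e * `|s|.
Proof.
move=> df cf fM e0.
have [eta eta0 H] := supp_unif_continuous cf (@derive_supp _ w _ fM) e0.
exists (eta / (`|w| + 1)); first by rewrite divr_gt0// ltr_wpDl.
move=> s l; rewrite ltr_pdivlMr; last by rewrite ltr_wpDl.
move=> sw; have [c cs ->] := mean_value_dir l s df.
rewrite -mulrBr normrM mulrC ler_wpM2r// H// addrAC subrr add0r normrZ.
apply: le_lt_trans sw; apply: ler_pM => //; by rewrite lerDl.
Qed.

End compact_support.

(* The set of [s] up to which the slope bound [e] holds is closed by
   continuity and can always be extended to the right. *)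
Lemma right_slope_le0 (R : realType) (chi : R -> R) (T : R) : 0 <= T ->
  (forall s, 0 <= s <= T -> forall e, 0 < e -> exists2 eta, 0 < eta &
     forall r, 0 <= r <= T -> `|r - s| < eta -> `|chi r - chi s| <= e) ->
  (forall s, 0 <= s < T -> forall e, 0 < e -> exists2 eta, 0 < eta &
     forall dl, 0 < dl < eta -> chi (s + dl) - chi s <= e * dl) ->
  chi T <= chi 0.
Proof.
move=> T0 cchi slope; apply/ler_addgt0Pr => e' e'0.
(* The error allowed per unit of time; the added 1 keeps the denominator positive when [T = 0]. *)
pose e := e' / (T + 1).
have e0 : 0 < e by rewrite divr_gt0// ltr_wpDl.
suff H : chi T - chi 0 <= e * T.
  rewrite -lerBlDl; apply: le_trans H _; rewrite /e mulrAC ler_pdivrMr ?ltr_wpDl//.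
  by rewrite ler_wpM2l ?ltW// ltrDl.
pose A := [set s | 0 <= s <= T /\ forall r, 0 <= r <= s -> chi r - chi 0 <= e * r].
have A0 : A 0.
  split=> [|r]; first by rewrite lexx.
  by move=> /andP[r0 r0']; rewrite (@le_anti _ _ r 0) ?r0 ?r0'// subrr mulr0.
have supA : has_sup A.
  by split; [exists 0|exists T => s [/andP[]]].
pose sg := sup A.
have sg0 : 0 <= sg by apply: sup_upper_bound.
have sgT : sg <= T by apply: ge_sup => [|s [/andP[]]//]; exists 0.
have ltsg r : 0 <= r < sg -> chi r - chi 0 <= e * r.
  move=> /andP[r0 rs]; have rs0 : 0 < sg - r by rewrite subr_gt0.
  have [s [_ As]] := sup_adherent rs0 supA.
  by rewrite -/sg subKr => rls; apply: As; rewrite r0 ltW.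
have lesg : chi sg - chi 0 <= e * sg.
  have [->|sgN0] := eqVneq sg 0; first by rewrite subrr mulr0.
  apply/ler_addgt0Pr => u u0.
  have [|eta eta0 Heta] := cchi sg _ u u0; first by rewrite sg0.
  pose r := Num.max 0 (sg - eta / 2).
  have rsg : r < sg.
    by rewrite /r gt_max lt_neqAle eq_sym sgN0 sg0/= ltrBlDr ltrDl divr_gt0.
  have r0 : 0 <= r by rewrite /r le_max lexx.
  have := ltsg r; rewrite r0 rsg => /(_ isT) chir.
  have := Heta r; rewrite r0 (le_trans (ltW rsg) sgT) => /(_ isT).
  rewrite ltr0_norm ?subr_lt0// opprB => Hr.
  have /Hr : sg - r < eta.
    apply: (@le_lt_trans _ _ (eta / 2)); last by rewrite ltr_pdivrMr// ltr_pMr// ltr1n.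
    by rewrite lerBlDl -lerBlDr /r le_max lexx orbT.
  rewrite distrC ler_norml => /andP[_ Hu].
  have : e * r <= e * sg by rewrite ler_pM2l// ltW.
  move: chir Hu; lra.
move: sgT; rewrite le_eqVlt => /orP[/eqP <-//|sgT].
have [|eta eta0 Heta] := slope sg _ e e0; first by rewrite sg0.
pose s := Num.min T (sg + eta / 2).
have sgs : sg < s by rewrite /s lt_min sgT ltrDl divr_gt0.
have : A s.
  split; first by rewrite (le_trans sg0 (ltW sgs))/= /s ge_min lexx.
  move=> r /andP[r0 rs]; have [rsg|rsg] := leP r sg.
    by move: rsg; rewrite le_eqVlt => /orP[/eqP -> //|rsg]; apply: ltsg; rewrite r0.
  have := Heta (r - sg); rewrite subr_gt0 rsg/= => H.
  have {}/H : r - sg < eta.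
    apply: (@le_lt_trans _ _ (eta / 2)); last by rewrite ltr_pdivrMr// ltr_pMr// ltr1n.
    by rewrite lerBlDl (le_trans rs)// /s ge_min lexx orbT.
  rewrite subrKC mulrBr; move: lesg; lra.
move=> /(sup_upper_bound supA); rewrite -/sg leNgt sgs.
by [].
Qed.
(** * Lebesgue measure on R^d *)

Section borel_Rd.
Variables (R : realType).

(** Balls with rational centre and radius [1 / (n + 1)] form a countable base. The set [D] selects
    those inside [U], which allows all of [nat] as index type. *)
Lemma open_bigcup_balls d (U : set 'rV[R]_d) : open U ->
  exists (D : set nat) (q : nat -> 'rV[R]_d) (r : nat -> R),
    (forall m, 0 < r m) /\ U = \bigcup_(m in D) [set l | `|l - q m| < r m].
Proof.
move=> oU; pose I := ('rV[rat]_d * nat)%type.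
(* Numbers coding no pair default to [(0, 0)], which is harmless since a ball counts only when it
   lies in [U]. *)
pose idx (k : nat) : I := odflt (0, 0%N) (unpickle k).
pose q k : 'rV[R]_d := \row_i ratr ((idx k).1 0 i).
pose r k : R := ((idx k).2.+1%:R)^-1.
exists [set k | [set l | `|l - q k| < r k] `<=` U], q, r.
split=> [m|]; first by rewrite /r invr_gt0.
apply/seteqP; split=> [l Ul|l [k /= kU]]; last exact: kU.
have /nbhs_ballP[e /= e0 He] := open_nbhs_nbhs (conj oU Ul).
have [n n0 ne] : exists2 n : nat, True & (n.+1%:R : R)^-1 < e / 2.
  exists (Num.truncn (e / 2)^-1) => //; rewrite invf_plt ?posrE ?divr_gt0//.
  exact: truncnS_gt.
have n1 : 0 < (n.+1%:R : R)^-1 by rewrite invr_gt0.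
have /choice[p Hp] : forall i, exists x : rat, `|l 0 i - ratr x| < (n.+1%:R)^-1.
  move=> i; have [|x] := @rat_in_itvoo R (l 0 i - (n.+1%:R)^-1) (l 0 i + (n.+1%:R)^-1).
    by rewrite ltrD2l gtrN.
  by rewrite in_itv/= => xI; exists x; rewrite ltr_distlC.
pose k := pickle ((\row_i p i, n) : I).
have Ek : idx k = (\row_i p i, n) by rewrite /idx pickleK.
have lk : `|l - q k| < r k.
  rewrite /r /q Ek/=; apply/row_norm_ltP => // i.
  by rewrite !mxE; exact: Hp.
exists k => //= l' l'k; apply: He; rewrite -ball_normE /=.
rewrite -(subrKA (q k)); apply: le_lt_trans (ler_normD _ _) _.
have rk : r k < e / 2 by rewrite /r Ek.
by rewrite [e]splitr ltrD// ?(lt_trans lk)// distrC (lt_trans l'k).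
Qed.

Lemma open_measurable_Rd d (U : set (Rd R d)) : open (U : set 'rV[R]_d) -> measurable U.
Proof. by move=> oU; exact: sub_sigma_algebra. Qed.

Lemma continuous_measurable_Rd d (h : 'rV[R]_d -> R) : continuous h ->
  measurable_fun [set: Rd R d] (h : Rd R d -> measurableTypeR R).
Proof.
move=> ch; apply: (measurability (@RGenOpens.G R)).
  exact: RGenOpens.measurableE.
move=> _ [_ [x [y ->]] <-]; rewrite setTI.
apply: open_measurable_Rd.
apply: (open_comp (f := h)); last exact: interval_open.
by move=> l _; exact: ch.
Qed.

Lemma open_ball_rV d (q : 'rV[R]_d) (r : R) : open [set l | `|l - q| < r].
Proof.
rewrite (_ : [set l | _] = ball q r); first exact: ball_open.
by rewrite -ball_normE; apply/seteqP; split=> l /=; rewrite distrC.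
Qed.

Lemma row_mx_norm_lt n (x : R) (y : 'rV[R]_n) (c : 'rV[R]_(1 + n)) (r : R) : 0 < r ->
  (`|row_mx (const_mx x : 'rV_1) y - c| < r) =
  (`|x - c 0 (lshift n 0)| < r) && (`|y - rsubmx c| < r).
Proof.
move=> r0; set z := row_mx _ _.
have zE k : (z - c) 0 k = z 0 k - c 0 k by rewrite [LHS]mxE [X in _ + X = _]mxE.
have zl : (z - c) 0 (lshift n 0) = x - c 0 (lshift n 0) by rewrite zE row_mxEl mxE.
have zr i : (z - c) 0 (rshift 1 i) = (y - rsubmx c) 0 i.
  by rewrite zE row_mxEr [RHS]mxE [X in _ = _ + X]mxE [X in _ = _ - X]mxE.
apply/idP/andP => [/row_norm_ltP - /(_ r0) H|[H1] /row_norm_ltP - /(_ r0) H2].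
  split; first by rewrite -zl.
  by apply/row_norm_ltP => // k; rewrite -zr.
apply/row_norm_ltP => // k; case: (split_ordP k) => i ->; last by rewrite zr.
by rewrite ord1 zl.
Qed.

Definition cons_rV n (z : measurableTypeR R * Rd R n) : Rd R n.+1 :=
  row_mx (const_mx z.1 : 'rV_1) (z.2 : 'rV[R]_n).

(** In the sup norm a ball of R^(n+1) is a product of two balls, hence a measurable rectangle, and
    every open set is a countable union of balls. *)
Lemma measurable_cons_rV n : measurable_fun setT (@cons_rV n).
Proof.
apply: (@measurability _ _ (measurableTypeR R * Rd R n)%type (Rd R n.+1) setT
  (@cons_rV n) (@open 'rV[R]_n.+1 : set (set (Rd R n.+1)))) => //.
move=> _ [U oU <-]; rewrite setTI.
have [D [q [r [r0 UE]]]] := open_bigcup_balls oU.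
rewrite UE preimage_bigcup; apply: bigcup_measurable => m _.
pose c : 'rV[R]_(1 + n) := q m.
rewrite (_ : _ @^-1` _ = [set x | `|x - c 0 (lshift n 0)| < r m] `*`
   [set y : 'rV_n | `|y - rsubmx c| < r m]).
  apply: measurableX; last by apply: open_measurable_Rd; exact: open_ball_rV.
  rewrite (_ : [set x | _] = ball (c 0 (lshift n 0)) (r m)); last first.
    by rewrite -ball_normE; apply/seteqP; split=> l /=; rewrite distrC.
  exact: measurable_ball.
apply/seteqP; split=> -[x y] /=.
  by rewrite /cons_rV/= (row_mx_norm_lt x y c (r0 m)) => /andP[].
by move=> [H1 H2]; rewrite /cons_rV/= (row_mx_norm_lt x y c (r0 m)) H1 H2.
Qed.

(** The translated measure agrees with Lebesgue measure on half-open intervals, which determine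
    it. *)
Lemma lebesgue_measure_shift (c : R) (A : set R) : measurable A ->
  lebesgue_measure ((fun x => x + c) @^-1` A) = lebesgue_measure A.
Proof.
move=> mA.
have mc : measurable_fun setT ((fun x => x + c) : measurableTypeR R -> measurableTypeR R).
  by apply: measurable_funD.
apply/esym/(@lebesgue_measure_unique _
  (measure_function_pushforward__canonical__measure_function_Measure lebesgue_measure mc)) => //=
  _ [[a b]] _ <-.
rewrite /pushforward.
rewrite (_ : _ @^-1` _ = `]a - c, b - c]%classic); last first.
  by apply/seteqP; split=> x /=; rewrite !in_itv/= ltrBlDr lerBrDr.
by rewrite !lebesgue_measure_itv/= !lte_fin ltrD2r -!EFinB opprB addrA subrK.
Qed.

Lemma ge0_integral_shift (c : R) (F : R -> \bar R) :
  measurable_fun setT F -> (forall x, 0 <= F x)%E ->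
  (\int[@lebesgue_measure R]_x F (x + c)%R = \int[@lebesgue_measure R]_x F x)%E.
Proof.
move=> mF F0.
have mc : measurable_fun setT ((fun x => x + c) : measurableTypeR R -> measurableTypeR R).
  by apply: measurable_funD.
have /esym := @ge0_integral_pushforward _ _ _ _ _ _ mc lebesgue_measure setT F
  measurableT mF (fun x _ => F0 x).
rewrite preimage_setT => ->.
by apply: eq_measure_integral => //= A mA _; exact: lebesgue_measure_shift.
Qed.

End borel_Rd.

(** * A measure on R^d representing the iterated integral *)

Section lebesgue_Rd.
Variables (R : realType).
Local Open Scope ereal_scope.

Definition is_lebesgue_Rd n (mu : {sigma_finite_measure set (Rd R n) -> \bar R}) :=
  [/\ forall F : Rd R n -> \bar R, measurable_fun setT F -> (forall x, 0 <= F x) ->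
        leb_int F = \int[mu]_x F x,
      forall (c : 'rV[R]_n) (r : R), (0 < r)%R -> 0 < mu [set l | `|l - c| < r]%R < +oo &
      forall (w : 'rV[R]_n) (F : Rd R n -> \bar R),
        measurable_fun setT F -> (forall x, 0 <= F x) ->
        \int[mu]_x F ((x : 'rV[R]_n) + w)%R = \int[mu]_x F x].

Lemma measurable_shift_Rd n (w : 'rV[R]_n) :
  measurable_fun setT ((fun x : 'rV[R]_n => (x + w)%R) : Rd R n -> Rd R n).
Proof.
apply: (@measurability _ _ (Rd R n) (Rd R n) setT _ (@open 'rV[R]_n : set (set (Rd R n)))) => //.
move=> _ [U oU <-]; rewrite setTI; apply: open_measurable_Rd.
apply: open_comp oU => l _.
by apply: (@continuousD _ _ _ id (cst w) l); [exact: cvg_id|exact: cst_continuous].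
Qed.

(** [leb_int] integrates one coordinate at a time, so the measure is built in the same way: the
    product of one-dimensional Lebesgue measure with [mu] is pushed forward along [cons_rV], and
    Tonelli identifies the integrals. *)
Lemma lebesgue_Rd_exists n :
  exists mu : {sigma_finite_measure set (Rd R n) -> \bar R}, is_lebesgue_Rd mu.
Proof.
elim: n => [|n [mu [intE muB muT]]].
  (* R^0 is a single point, of mass one. *)
  exists (@dirac _ (Rd R 0) 0%R R); split.
  - by move=> F mF F0 /=; rewrite integral_dirac// diracT mul1e.
  - move=> c r r0; rewrite /= diracE mem_set/= ?lte01 ?ltry//.
    by rewrite [X in (`|X|)%R]thinmx0 normr0.
  - move=> w F mF F0; congr integral; apply/funext => x.
    by congr F; rewrite [LHS]thinmx0 [RHS]thinmx0.
pose pm := product_measure1 (@lebesgue_measure R) mu.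
pose nu0 : {measure set (Rd R n.+1) -> \bar R} :=
  measure_function_pushforward__canonical__measure_function_Measure pm
    (@measurable_cons_rV R n).
have nuB (c : 'rV[R]_n.+1) (r : R) : (0 < r)%R ->
    nu0 [set l | `|l - c| < r]%R =
    lebesgue_measure (ball ((c : 'rV_(1 + n)) 0 (lshift n 0))%R r) *
    mu [set l | `|l - rsubmx (c : 'rV_(1 + n))| < r]%R.
  move=> r0; rewrite -product_measure1E//.
  - congr (pm _); apply/seteqP; split=> -[x y] /=.
      rewrite /cons_rV/= (row_mx_norm_lt x y c r0) -ball_normE /= distrC.
      by move=> /andP[].
    move=> []; rewrite -ball_normE /= distrC => H1 H2.
    by rewrite /cons_rV/= (row_mx_norm_lt x y c r0) H1 H2.
  - exact: measurable_ball.
  - by apply: open_measurable_Rd; exact: open_ball_rV.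
have nuB' (c : 'rV[R]_n.+1) (r : R) : (0 < r)%R -> 0 < nu0 [set l | `|l - c| < r]%R < +oo.
  move=> r0; rewrite nuB// lebesgue_measure_ball ?ltW//.
  have /andP[m0 moo] := muB (rsubmx (c : 'rV_(1 + n))) r r0.
  apply/andP; split.
    by apply: mule_gt0 => //; rewrite lte_fin pmulrn_lgt0.
  by rewrite lte_mul_pinfty// ?lee_fin ?mulrn_wge0// ltW.
(* The next induction step takes a product with this measure, which requires sigma-finiteness; balls
   of integer radius provide it. *)
have sf : sigma_finite setT nu0.
  exists (fun k => [set l : 'rV[R]_n.+1 | `|l - 0| < k.+1%:R]%R).
    apply/seteqP; split=> // l _; exists (Num.truncn `|l|%R) => //=.
    by rewrite subr0; exact: truncnS_gt.
  move=> k; split; first by apply: open_measurable_Rd; exact: open_ball_rV.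
  by have /(_ _)/andP[|] := nuB' 0%R k.+1%:R.
pose nu : {sigma_finite_measure set (Rd R n.+1) -> \bar R} :=
  HB.pack_for (sigma_finite_measure (Rd R n.+1) R) (nu0 : set (Rd R n.+1) -> \bar R)
  (Measure.class nu0) (Measure_isSigmaFinite.Build _ _ _ nu0 sf).
have nuE (F : Rd R n.+1 -> \bar R) : measurable_fun setT F -> (forall x, 0 <= F x) ->
    \int[nu]_x F x = \int[@lebesgue_measure R]_x \int[mu]_y F (cons_rV (x, y)).
  move=> mF F0.
  have := @ge0_integral_pushforward _ _ _ _ _ _ (@measurable_cons_rV R n) pm setT F
    measurableT mF (fun x _ => F0 x).
  rewrite preimage_setT => E.
  transitivity (\int[pm]_z (F \o @cons_rV R n) z); first exact: E.
  rewrite /pm fubini_tonelli1//; last by move=> z; exact: F0.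
  exact: measurableT_comp mF (@measurable_cons_rV R n).
exists nu; split=> [F mF F0| |w F mF F0].
- rewrite nuE//=; apply: eq_integral => x _; rewrite -intE//.
  exact: measurableT_comp (measurableT_comp mF (@measurable_cons_rV R n)) (pair1_measurable x).
- exact: nuB'.
- rewrite (nuE _ mF F0) (nuE _ (measurableT_comp mF (measurable_shift_Rd w)) (fun x => F0 _)).
  have mFc := measurableT_comp mF (@measurable_cons_rV R n).
  pose G (x : measurableTypeR R) := \int[mu]_y F (cons_rV (x, y)).
  (* The shift splits: the inner integral absorbs the last coordinates of [w] by induction, the
     outer one its first coordinate. *)
  transitivity (\int[@lebesgue_measure R]_x G (x + (w : 'rV_(1 + n)) 0 (lshift n 0))%R).
    apply: eq_integral => x _; rewrite /G.
    set c := (x + _)%R; pose w1 : 'rV[R]_(1 + n) := w.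
    rewrite -[RHS](muT (rsubmx w1) (fun y => F (cons_rV (c, y))) _ (fun y => F0 _)).
      apply: eq_integral => y _; congr F; rewrite /cons_rV/=.
      have -> : w = row_mx (lsubmx w1) (rsubmx w1) by rewrite hsubmxK.
      apply: (etrans (@add_row_mx R 1 1 n (const_mx x) y (lsubmx w1) (rsubmx w1))).
      congr row_mx.
      by apply/rowP => i; rewrite !mxE !ord1.
    exact: measurableT_comp mFc (pair1_measurable _).
  apply: ge0_integral_shift.
    exact: (@measurable_fun_fubini_tonelli_F _ _ _ _ R mu (F \o @cons_rV R n) mFc (fun z => F0 _)).
  by move=> x; apply: integral_ge0 => y _; exact: F0.
Qed.

End lebesgue_Rd.
(** * The transition semigroup *)

Definition mbounded (R : realType) d (T : measurableType d) (f : T -> R) : Prop :=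
  measurable_fun setT f /\ exists M : R, forall x, `|f x| <= M.

Section mbounded_theory.
Context (R : realType) d (T : measurableType d).
Implicit Types (f h : T -> R).

Lemma mbounded_cst (c : R) : mbounded (fun _ : T => c).
Proof. by split; [exact: measurable_cst|exists `|c|]. Qed.

Lemma mboundedD f h : mbounded f -> mbounded h -> mbounded (fun x => f x + h x).
Proof.
move=> [mf [M fM]] [mh [K hK]]; split; first exact: measurable_funD.
by exists (M + K) => x; apply: le_trans (ler_normD _ _) _; exact: lerD.
Qed.

Lemma mboundedM f h : mbounded f -> mbounded h -> mbounded (fun x => f x * h x).
Proof.
move=> [mf [M fM]] [mh [K hK]]; split; first exact: measurable_funM.
by exists (M * K) => x; rewrite normrM ler_pM.
Qed.

Lemma mboundedZ (c : R) f : mbounded f -> mbounded (fun x => c * f x).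
Proof. by move=> mf; exact: mboundedM (mbounded_cst c) mf. Qed.

Lemma mboundedB f h : mbounded f -> mbounded h -> mbounded (fun x => f x - h x).
Proof.
move=> mf mh; have := mboundedD mf (mboundedZ (-1) mh).
by under eq_fun do rewrite mulN1r.
Qed.

Lemma mbounded_indic (A : set T) : measurable A -> mbounded (\1_A : T -> R).
Proof.
move=> mA; split; first exact: measurable_indic.
by exists 1 => x; rewrite indicE; case: (x \in A); rewrite ?normr1// normr0.
Qed.

Lemma mbounded_sum (I : Type) (r : seq I) (Q : pred I) (F : I -> T -> R) :
  (forall i, Q i -> mbounded (F i)) ->
  mbounded (fun x => \sum_(i <- r | Q i) F i x).
Proof.
move=> MF; elim: r => [|i r IH].
  by under eq_fun do rewrite big_nil; exact: mbounded_cst.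
under eq_fun do rewrite big_cons.
by case: (boolP (Q i)) => [Qi|_]; [exact: mboundedD (MF _ Qi) IH|exact: IH].
Qed.

Lemma mbounded_integrable (mu : {measure set T -> \bar R}) f :
  (mu setT < +oo)%E -> mbounded f -> mu.-integrable setT (EFin \o f).
Proof.
move=> muoo [mf [M fM]]; apply: measurable_bounded_integrable => //.
exists M; split; first exact: num_real.
by move=> K /= MK x _; exact: le_trans (fM x) (ltW MK).
Qed.

(* Every bounded measurable function is within [e] of
   [-M + sum_(k < n) e 1_{f >= -M + e (k + 1)}]. *)
Lemma mbounded_ind (C : (T -> R) -> Prop) :
  (forall A, measurable A -> C \1_A) ->
  (forall f h c, mbounded f -> mbounded h -> C f -> C h ->
     C (fun x => f x + c * h x)) ->
  (forall f, mbounded f -> (forall e : R, 0 < e -> exists h,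
     [/\ mbounded h, C h & forall x, `|f x - h x| <= e]) -> C f) ->
  forall f, mbounded f -> C f.
Proof.
move=> C1_ CD Clim f mf; apply: (Clim _ mf) => e e0.
have [mmf [M fM]] := mf.
pose A k : set T := [set x | - M + e * k.+1%:R <= f x].
have mA k : measurable (A k).
  rewrite -[A k]setTI.
  have -> : A k = f @^-1` `[- M + e * k.+1%:R, +oo[%classic.
    by apply/seteqP; split=> x /=; rewrite in_itv/= andbT.
  exact: mmf.
pose S n x := - M * \1_setT x + \sum_(k < n) e * \1_(A k) x.
have mC n : mbounded (S n) /\ C (S n).
  elim: n => [|n [mS CS]].
    (* [C] is closed under [f + c * h] only, so the constant [- M] has to start from an
       indicator. *)
    rewrite (_ : S 0%N = fun x => \1_setT x + (- M - 1) * \1_setT x).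
      by split; [apply: mboundedD; [|apply: mboundedZ]; exact: mbounded_indic
        |apply: CD; do ?[exact: mbounded_indic]; exact: C1_].
    by apply/funext => x; rewrite /S big_ord0 addr0 mulrBl mul1r addrCA subrr addr0.
  rewrite (_ : S n.+1 = fun x => S n x + e * \1_(A n) x).
    split; first by apply: mboundedD => //; apply: mboundedZ; exact: mbounded_indic.
    by apply: CD => //; [exact: mbounded_indic|exact: C1_].
  by apply/funext => x; rewrite /S big_ord_recr/= addrA.
pose n := Num.truncn (2 * M / e).
exists (S n.+1); have [? ?] := mC n.+1; split=> // x.
have := fM x; rewrite ler_norml => /andP[fl fu].
have M0 : 0 <= M := le_trans (normr_ge0 _) (fM x).
pose u := (f x + M) / e.
have u0 : 0 <= u by rewrite divr_ge0 ?(ltW e0)//; lra.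
pose m := Num.truncn u.
have mu1 : m%:R <= u < m.+1%:R by exact: truncn_itv.
have mn : (m <= n)%N.
  apply: le_truncn; rewrite /u ler_pM2r ?invr_gt0//; lra.
have fE : f x = - M + e * u by rewrite /u mulrC divfK ?gt_eqF//; ring.
have SE : S n.+1 x = - M + e * m%:R.
  rewrite /S indicE mem_set// mulr1; congr (_ + _).
  rewrite (eq_bigr (fun k : 'I_n.+1 => if (k < m)%N then e else 0)); last first.
    move=> k _; rewrite indicE.
    have -> : (x \in A k) = (k < m)%N.
      apply/idP/idP => [/set_mem|km].
        rewrite /A/= fE lerD2l ler_pM2l// => ku.
        have : (k.+1%:R : R) < m.+1%:R.
          by apply: le_lt_trans ku _; case/andP: mu1.
        by rewrite ltr_nat ltnS.
      apply/mem_set; rewrite /A/= fE lerD2l ler_pM2l//.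
      by case/andP: mu1 => mu1 _; apply: le_trans mu1; rewrite ler_nat.
    by case: ifP; rewrite ?mulr1 ?mulr0.
  rewrite -big_mkcond/= -(big_ord_widen _ (fun=> e)) ?leqW//.
  by rewrite sumr_const card_ord mulr_natr.
rewrite SE fE (_ : _ - _ = e * (u - m%:R)); last by ring.
rewrite normrM (gtr0_norm e0) ler_piMr ?(ltW e0)//.
move/andP: mu1 => [m1 m2]; rewrite ger0_norm ?subr_ge0//.
by rewrite lerBlDl; move: m2; rewrite -natr1 addrC => /ltW.
Qed.

End mbounded_theory.
(* No measurability is needed, the integral being a difference of suprema over
   simple functions. *)
Lemma le_integral_nonmeasurable (R : realType) d (T : measurableType d)
  (mu : {measure set T -> \bar R}) (D : set T) (f h : T -> \bar R) :
  (forall x, D x -> (f x <= h x)%E) ->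
  (\int[mu]_(x in D) f x <= \int[mu]_(x in D) h x)%E.
Proof.
move=> fh; have fhD x : ((f \_ D) x <= (h \_ D) x)%E.
  by rewrite !patchE; case: ifPn => // /set_mem; exact: fh.
rewrite /integral; apply: leeB; apply: ereal_sup_le => _ [k kf <-]; exists k => //= x;
  apply: le_trans (kf x) _.
  by apply: funepos_le (in_setT x) => y _.
by apply: funeneg_le (in_setT x) => y _.
Qed.

(** In Dynkin's formula the integrand is not known to be measurable in time. Sandwiching it between
    the constants [c - kappa] and [c + kappa] both shows that the integral is finite and locates
    it. *)
Lemma integral_near_cst (R : realType) (t c kappa : R) (G : R -> R) : 0 <= t ->
  (forall s, 0 <= s <= t -> `|G s - c| <= kappa) ->
  exists2 I : R, (\int[@lebesgue_measure R]_(s in [set s : R | (0 <= s <= t)%R]) (G s)%:E)%E = I%:E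
    & `|I - t * c| <= t * kappa.
Proof.
move=> t0 Gc; set D := [set s : R | _].
have DE : D = `[0, t]%classic by apply/seteqP; split=> x; rewrite /D/= in_itv.
have cstE (k : R) : (\int[@lebesgue_measure R]_(s in D) k%:E = (k * t)%:E)%E.
  rewrite DE integral_cst//= lebesgue_measure_itv/= lte_fin.
  by case: ltP => t0'; rewrite ?oppr0 ?addr0// (@le_anti _ _ t 0) ?t0 ?t0'// mulr0 mule0.
have l1 : (((c - kappa) * t)%:E <= \int[@lebesgue_measure R]_(s in D) (G s)%:E)%E.
  rewrite -cstE; apply: le_integral_nonmeasurable => s Ds; rewrite lee_fin.
  by have := Gc _ Ds; rewrite ler_norml; lra.
have l2 : (\int[@lebesgue_measure R]_(s in D) (G s)%:E <= ((c + kappa) * t)%:E)%E.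
  rewrite -cstE; apply: le_integral_nonmeasurable => s Ds; rewrite lee_fin.
  by have := Gc _ Ds; rewrite ler_norml; lra.
move: l1 l2; case: (\int[_]_(_ in _) _)%E => // I; rewrite ?lee_fin => l1 l2.
by exists I => //; rewrite ler_norml; apply/andP; split; nra.
Qed.

Section semigroup.
Variables (R : realType) (N d : nat) (v : 'I_N -> 'rV[R]_d).
Variables (a : 'I_N -> 'I_N -> 'rV[R]_d -> R) (P : trans_fun R N d).
Hypothesis hP : is_process_semigroup v a P.
Implicit Types (s t c e M : R) (i j : 'I_N) (l : 'rV[R]_d).

Definition mbstate (f : 'I_N -> 'rV[R]_d -> R) : Prop :=
  forall i, mbounded (f i : Rd R d -> R).

Definition semigroup (t : R) (f : 'I_N -> 'rV[R]_d -> R) (j : 'I_N) (l : 'rV[R]_d) : R :=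
  \sum_(i < N) Rintegral (P t j l i) setT (f i : Rd R d -> R).

Lemma mbstate_bound f : mbstate f -> exists2 M, 0 <= M & forall i l, `|f i l| <= M.
Proof.
move=> mf; have /choice[M HM] : forall i, exists M, forall l, `|f i l| <= M.
  by move=> i; have [_ []] := mf i => M; exists M.
exists (\sum_i `|M i|); first exact: sumr_ge0.
move=> i l; apply: le_trans (HM i l) _; apply: le_trans (ler_norm _) _.
by rewrite (bigD1 i)//= lerDl sumr_ge0.
Qed.

Lemma kernel_le1 t j l i : 0 <= t -> (P t j l i setT <= 1)%E.
Proof.
move=> t0; case: hP => _ /(_ t j l t0) <- _ _ _.
by rewrite (bigD1 i)//= leeDl// sume_ge0.
Qed.

Lemma kernel_fin t j l i (B : set (Rd R d)) : 0 <= t -> measurable B ->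
  P t j l i B \is a fin_num.
Proof.
move=> t0 mB; rewrite ge0_fin_numE//; apply: le_lt_trans (ltry 1).
apply: le_trans (kernel_le1 j l i t0).
by apply: le_measure => //; rewrite ?inE.
Qed.

Lemma kernel_integrable t j l i (f : Rd R d -> R) : 0 <= t -> mbounded f ->
  (P t j l i).-integrable setT (EFin \o f).
Proof.
move=> t0; apply: mbounded_integrable.
by apply: le_lt_trans (ltry 1); exact: kernel_le1.
Qed.

Lemma semigroup_mass t j l : 0 <= t -> \sum_(i < N) fine (P t j l i setT) = 1.
Proof.
move=> t0; case: hP => _ /(_ t j l t0) E _ _ _; apply: EFin_inj.
rewrite -sumEFin -[RHS]E; apply: eq_bigr => i _.
by rewrite fineK// kernel_fin.
Qed.

Lemma semigroup_bound t f M : 0 <= t -> mbstate f -> (forall i l, `|f i l| <= M) ->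
  forall j l, `|semigroup t f j l| <= M.
Proof.
move=> t0 mf fM j l.
rewrite -[M]mulr1 -(semigroup_mass j l t0) mulr_sumr.
apply: le_trans (ler_norm_sum _ _ _) _; apply: ler_sum => i _.
rewrite -(Rintegral_cst (P t j l i) measurableT).
apply: le_trans; first apply: le_normr_Rintegral => //; first exact: kernel_integrable.
apply: le_Rintegral => //.
- apply: (@kernel_integrable t j l i (fun x => `|f i x|)) => //.
  have [mm [K HK]] := mf i; split; last by exists K => x; rewrite normr_id.
  by apply: measurableT_comp mm.
- apply: (@kernel_integrable t j l i (cst M)) => //.
  exact: mbounded_cst.
Qed.

Lemma semigroupD t f h : 0 <= t -> mbstate f -> mbstate h ->
  semigroup t (fun i l => f i l + h i l) = fun j l => semigroup t f j l + semigroup t h j l.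
Proof.
move=> t0 mf mh; apply/funext => j; apply/funext => l.
rewrite /semigroup -big_split/=; apply: eq_bigr => i _.
rewrite RintegralD//; exact: kernel_integrable.
Qed.

Lemma semigroupZ t c f : 0 <= t -> mbstate f ->
  semigroup t (fun i l => c * f i l) = fun j l => c * semigroup t f j l.
Proof.
move=> t0 mf; apply/funext => j; apply/funext => l.
rewrite /semigroup mulr_sumr; apply: eq_bigr => i _.
rewrite RintegralZl//; exact: kernel_integrable.
Qed.

Lemma semigroupB t f h : 0 <= t -> mbstate f -> mbstate h ->
  semigroup t (fun i l => f i l - h i l) = fun j l => semigroup t f j l - semigroup t h j l.
Proof.
move=> t0 mf mh; apply/funext => j; apply/funext => l.
rewrite /semigroup -sumrB/=; apply: eq_bigr => i _.
rewrite RintegralB//; exact: kernel_integrable.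
Qed.

Lemma mbstateD f h : mbstate f -> mbstate h -> mbstate (fun i l => f i l + h i l).
Proof. by move=> mf mh i; exact: mboundedD. Qed.

Lemma mbstateB f h : mbstate f -> mbstate h -> mbstate (fun i l => f i l - h i l).
Proof. by move=> mf mh i; exact: mboundedB. Qed.

Lemma mbstateZ c f : mbstate f -> mbstate (fun i l => c * f i l).
Proof. by move=> mf i; exact: mboundedZ. Qed.

Lemma kernel_linear t j l i (f h : Rd R d -> R) c : 0 <= t ->
  mbounded f -> mbounded h ->
  Rintegral (P t j l i) setT (fun x => f x + c * h x) =
  Rintegral (P t j l i) setT f + c * Rintegral (P t j l i) setT h.
Proof.
move=> t0 mf mh; have If := kernel_integrable j l i t0 mf.
have Ih := kernel_integrable j l i t0 mh.
have Ich := kernel_integrable j l i t0 (mboundedZ c mh).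
by rewrite (RintegralD measurableT If Ich) (RintegralZl _ measurableT Ih).
Qed.

Lemma Rintegral_indic_kernel t j l i (B : set (Rd R d)) : measurable B ->
  Rintegral (P t j l i) setT (\1_B : Rd R d -> R) = fine (P t j l i B).
Proof. by move=> mB; rewrite /Rintegral integral_indic// setIT. Qed.

Lemma Rintegral_kernel_close t j l i (f h : Rd R d -> R) (e : R) : 0 <= t ->
  0 <= e -> mbounded f -> mbounded h -> (forall x, `|f x - h x| <= e) ->
  `|Rintegral (P t j l i) setT f - Rintegral (P t j l i) setT h| <= e.
Proof.
move=> t0 e0 mf mh fh; rewrite -RintegralB//; [|exact: kernel_integrable..].
have mB := mboundedB mf mh.
apply: le_trans; first apply: le_normr_Rintegral => //; first exact: kernel_integrable.
apply: (@le_trans _ _ (Rintegral (P t j l i) setT (cst e))).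
  apply: le_Rintegral => //.
    apply: (@kernel_integrable t j l i (fun x => `|f x - h x|)) => //.
    have [mm [K HK]] := mB; split; last by exists K => x; rewrite normr_id.
    by apply: measurableT_comp mm.
  by apply: (@kernel_integrable t j l i (cst e)) => //; exact: mbounded_cst.
rewrite (Rintegral_cst (P t j l i) measurableT) ler_piMr//.
by rewrite -lee_fin fineK ?kernel_fin// kernel_le1.
Qed.

(** Measurability in the starting point is given for sets; [mbounded_ind] carries it to functions,
    uniform limits being preserved because the kernels have mass at most 1. *)
Lemma mbounded_kernel t j i (f : Rd R d -> R) : 0 <= t -> mbounded f ->
  mbounded (fun l : Rd R d => Rintegral (P t j l i) setT f).
Proof.
move=> t0 mf; split; last first.
  have [_ [M fM]] := mf; exists `|M| => l.
  have := @Rintegral_kernel_close t j l i f (cst 0) `|M| t0 (normr_ge0 _) mf (mbounded_cst _ 0).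
  rewrite (Rintegral_cst (P t j l i) measurableT) mul0r subr0; apply=> x.
  by rewrite subr0; apply: le_trans (fM x) (ler_norm _).
move: f mf; apply: mbounded_ind => [A mA|f h c mf mh Cf Ch|f mf H].
- under eq_fun do rewrite Rintegral_indic_kernel//.
  apply: (@measurableT_comp _ _ _ _ _ _ fine); first exact: fine_measurable.
  by case: hP => _ _ + _ _; apply.
- under eq_fun do rewrite kernel_linear//.
  by apply: measurable_funD => //; exact: measurable_funM.
- have /choice[F HF] : forall n : nat, exists h, [/\ mbounded h,
      measurable_fun setT (fun l : Rd R d => Rintegral (P t j l i) setT h) &
      forall x, `|f x - h x| <= n.+1%:R^-1].
    by move=> n; apply: H; rewrite invr_gt0.
  apply: (@measurable_fun_cvg _ _ _ setT
    (fun n (l : Rd R d) => Rintegral (P t j l i) setT (F n))) => [n|l _].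
    by have [] := HF n.
  apply/cvgrPdist_le => /= e e0; near=> n.
  have [mFn _ Hn] := HF n.
  apply: le_trans (_ : n.+1%:R^-1 <= e).
    by apply: Rintegral_kernel_close => //; rewrite invr_ge0.
  by apply: ltW; near: n; exact: (near_infty_natSinv_lt (PosNum e0)).
Unshelve. all: by end_near. Qed.

Lemma mbstate_semigroup t f : 0 <= t -> mbstate f -> mbstate (semigroup t f).
Proof.
move=> t0 mf j.
suff : mbounded (fun l : Rd R d => \sum_(i < N) Rintegral (P t j l i) setT (f i)) by [].
apply: mbounded_sum.
by move=> i _; exact: mbounded_kernel.
Qed.

Lemma kernel_comp s t j l i (f : Rd R d -> R) : 0 <= s -> 0 <= t -> mbounded f ->
  Rintegral (P (s + t) j l i) setT f =
  \sum_(k < N) Rintegral (P s j l k) setT (fun y : Rd R d => Rintegral (P t k y i) setT f).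
Proof.
move=> s0 t0; have st0 : 0 <= s + t by rewrite addr_ge0.
move: f; apply: mbounded_ind => [A mA|f h c mf mh Cf Ch|f mf H].
- rewrite Rintegral_indic_kernel//; apply: EFin_inj.
  rewrite fineK ?kernel_fin//; case: hP => _ _ _ /(_ s t j l i A s0 t0 mA) -> _.
  rewrite -sumEFin; apply: eq_bigr => k _.
  rewrite /Rintegral fineK; last first.
    apply: integrable_fin_num => //; apply: kernel_integrable => //.
    by apply: mbounded_kernel => //; exact: mbounded_indic.
  apply: eq_integral => y _.
  by rewrite integral_indic// setIT fineK// kernel_fin.
- rewrite (kernel_linear _ _ _ _ st0 mf mh) Cf Ch mulr_sumr -big_split/=; apply: eq_bigr => k _.
  have mk (u : Rd R d -> R) : mbounded u ->
      mbounded (fun y : Rd R d => Rintegral (P t k y i) setT u).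
    exact: mbounded_kernel.
  rewrite -(kernel_linear _ _ _ _ s0 (mk _ mf) (mk _ mh)).
  by apply: eq_Rintegral => y _; rewrite kernel_linear.
- apply/eqP; rewrite -subr_eq0 -normr_le0; apply/ler_addgt0Pr => e e0; rewrite add0r.
  (* One share of [e] for replacing [f] by [h] on the left, and one for each of the [N] intermediate
     states on the right. *)
  have e'0 : 0 < e / (N%:R + 1) by rewrite divr_gt0// ltr_wpDl.
  have [h [mh E Hh]] := H _ e'0.
  rewrite -(subrKA (Rintegral (P (s + t) j l i) setT h)) {2}E.
  apply: le_trans (ler_normD _ _) _.
  rewrite -[leRHS](@divfK _ (N%:R + 1)) ?gt_eqF ?ltr_wpDl// mulrDr mulr1 addrC.
  apply: lerD; last by apply: Rintegral_kernel_close => //; exact: ltW.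
  rewrite -sumrB; apply: le_trans (ler_norm_sum _ _ _) _.
  have -> : e / (N%:R + 1) * N%:R = \sum_(k < N) e / (N%:R + 1).
    by rewrite sumr_const card_ord mulr_natr.
  apply: ler_sum => k _.
  apply: Rintegral_kernel_close (ltW e'0) _ _ _ => //; try exact: mbounded_kernel.
  by move=> y; rewrite distrC; exact: (Rintegral_kernel_close _ _ _ t0 (ltW e'0) mf mh Hh).
Qed.

Lemma semigroup_comp s t f : 0 <= s -> 0 <= t -> mbstate f ->
  semigroup (s + t) f = semigroup s (semigroup t f).
Proof.
move=> s0 t0 mf; apply/funext => j; apply/funext => l.
rewrite /semigroup; under eq_bigr do rewrite kernel_comp//.
rewrite exchange_big/=; apply: eq_bigr => k _.
have mk i : mbounded (fun y : Rd R d => Rintegral (P t k y i) setT (f i)).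
  exact: mbounded_kernel.
elim: (index_enum 'I_N) => [|i r IH].
  rewrite big_nil; under [RHS]eq_Rintegral do rewrite big_nil.
  by rewrite Rintegral_cst// mul0r.
rewrite big_cons; under [RHS]eq_Rintegral do rewrite big_cons.
rewrite IH RintegralD//; apply: kernel_integrable => //.
exact: mbounded_sum.
Qed.

(** * Dynkin's formula on test functions *)

Definition Cc_state (f : 'I_N -> 'rV[R]_d -> R) : Prop :=
  (forall j, continuous (f j)) /\ exists M : R, forall j l, M < `|l| -> f j l = 0.

Local Notation gen := (generator v a).

Lemma test_funP (f : 'I_N -> 'rV[R]_d -> R) :
  test_fun f <-> (forall j, C1 (f j)) /\ exists M : R, forall j l, M < `|l| -> f j l = 0.
Proof.
split=> [tf|[Cf [M fM]] j]; last first.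
  by have [? ?] := Cf j; split=> //; split=> //; exists M; exact: fM.
split=> [j|]; first by have [? []] := tf j.
have /choice[M HM] : forall j, exists M : R, forall l, M < `|l| -> f j l = 0.
  by move=> j; have [_ []] := tf j.
exists (\sum_j `|M j|) => j l lM; apply: HM; apply: le_lt_trans lM.
by apply: le_trans (ler_norm _) _; rewrite (bigD1 j)//= lerDl sumr_ge0.
Qed.

Lemma test_fun_Cc f : test_fun f -> Cc_state f.
Proof. by move=> /test_funP[Cf fM]; split=> // j; exact: C1_continuous. Qed.

Lemma Cc_mbstate f : Cc_state f -> mbstate f.
Proof.
move=> [cf [M fM]] i; split; first exact: continuous_measurable_Rd.
by have [B _ fB] := supp_bounded (cf i) (fM i); exists B.
Qed.

Lemma test_fun_mbstate f : test_fun f -> mbstate f.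
Proof. by move=> tf; apply: Cc_mbstate; exact: test_fun_Cc. Qed.

Hypothesis hac : forall i j, i != j -> continuous (a i j).

(** With rates that are only continuous, [A f] need not be a test function; this weaker class is
    where it lives and where strong continuity has to be proved. *)
Lemma generator_Cc f : test_fun f -> Cc_state (gen f).
Proof.
move=> /test_funP[Cf [M fM]]; split=> [j|].
  rewrite /generator; apply: ctsD; first by have [_] := Cf j; apply.
  apply: cts_sum => i ij; apply: ctsM; first by apply: hac; rewrite eq_sym.
  by apply: ctsB; exact: C1_continuous.
exists M => j l lM; rewrite /generator (@derive_supp _ _ _ (v j) _ (fM j) _ lM) add0r big1// => i _.
by rewrite !fM// subrr mulr0.
Qed.

Lemma Cc_approx h e : Cc_state h -> 0 < e ->
  exists2 f, test_fun f & forall j l, `|h j l - f j l| <= e.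
Proof.
move=> [ch [M hM]] e0.
(* The interpolant of [h] can be nonzero only up to radius [M + 1], so closeness on that ball gives
   closeness everywhere. *)
have /choice[f Hf] := fun j => C1_approx (M + 1) (ch j) e0.
have fM j l : M + 1 < `|l| -> f j l = 0.
  move=> lM; have [_ _] := Hf j; apply=> q ql; apply: hM.
  rewrite -(ltrD2r 1); apply: lt_trans lM _.
  rewrite -{1}(subrKC q l); apply: le_lt_trans (ler_normD _ _) _.
  by rewrite ltrD2l distrC.
exists f => [|j l].
  by apply/test_funP; split=> [j|]; [have [] := Hf j|exists (M + 1)].
rewrite distrC; have [_ Hl _] := Hf j; have [/Hl//|lM] := leP `|l| (M + 1).
rewrite fM// hM ?subrr ?normr0 ?ltW//; apply: lt_trans lM; by rewrite ltrDl.
Qed.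

Lemma kintE t j l i (h : Rd R d -> R) : 0 <= t -> mbounded h ->
  kint (P t j l i) h = (Rintegral (P t j l i) setT h)%:E.
Proof.
move=> t0 mh; rewrite /kint /Rintegral fineK//.
by apply: integrable_fin_num => //; exact: kernel_integrable.
Qed.

(** One estimate for two uses: [c = 0], with [kappa] a bound on [A f], yields continuity at time 0;
    the value of [A f] as [c] then yields the first order expansion. *)
Lemma semigroup_near f t j l c (kappa : R) : test_fun f -> 0 <= t ->
  (forall s, 0 <= s <= t -> `|semigroup s (gen f) j l - c| <= kappa) ->
  `|semigroup t f j l - f j l - t * c| <= t * kappa.
Proof.
move=> tf t0 Hk; have [I IE HI] := integral_near_cst t0 Hk.
suff -> : semigroup t f j l = f j l + I.
  by rewrite (_ : _ - _ - _ = I - t * c)//; ring.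
apply: EFin_inj; rewrite EFinD -IE /semigroup -sumEFin.
rewrite (eq_bigr (fun i => kint (P t j l i) (f i))); last first.
  by move=> i _; rewrite kintE//; exact: test_fun_mbstate.
case: hP => _ _ _ _ /(_ f tf t j l t0) ->; congr (_ + _)%E.
apply: eq_integral => s; rewrite inE/= => /andP[s0 _].
rewrite -sumEFin; apply: eq_bigr => i _; rewrite kintE//.
by apply: Cc_mbstate; exact: generator_Cc.
Qed.

Lemma semigroup_continuous0 h e : Cc_state h -> 0 < e ->
  exists2 eta, 0 < eta & forall s j l, 0 <= s <= eta -> `|semigroup s h j l - h j l| <= e.
Proof.
move=> Ch e0; have e30 : 0 < e / 3 by rewrite divr_gt0.
have [f tf Hf] := Cc_approx Ch e30.
have mf := test_fun_mbstate tf; have mh := Cc_mbstate Ch.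
have mg := Cc_mbstate (generator_Cc tf).
have [B B0 HB] := mbstate_bound mg.
exists (e / 3 / (B + 1)); first by rewrite divr_gt0// ltr_wpDl.
move=> s j l /andP[s0]; rewrite ler_pdivlMr ?ltr_wpDl// => sB.
have H1 : `|semigroup s f j l - f j l| <= e / 3.
  have := @semigroup_near f s j l 0 B tf s0 _.
  rewrite mulr0 subr0; move=> /(_ _)/le_trans; apply; last first.
    by apply: le_trans sB; rewrite ler_wpM2l// lerDl.
  by move=> r /andP[r0 _]; rewrite subr0; exact: semigroup_bound.
have H2 : `|semigroup s (fun i x => h i x - f i x) j l| <= e / 3.
  by apply: semigroup_bound => //; exact: mbstateB.
have H3 := Hf j l; move: H2; rewrite semigroupB//.
have := H1; have := H3; rewrite !ler_norml.
by move=> /andP[? ?] /andP[? ?] /andP[? ?]; apply/andP; split; lra.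
Qed.

Lemma semigroup_slope f e : test_fun f -> 0 < e ->
  exists2 eta, 0 < eta & forall s j l, 0 <= s <= eta ->
    `|semigroup s f j l - f j l - s * gen f j l| <= e * s.
Proof.
move=> tf e0; have [eta eta0 H] := semigroup_continuous0 (generator_Cc tf) e0.
exists eta => // s j l /andP[s0 seta]; rewrite [leRHS]mulrC; apply: semigroup_near => //.
by move=> r /andP[r0 rs]; apply: H; rewrite r0 (le_trans rs).
Qed.

End semigroup.
(** * Uniqueness for the forward equation *)

Section invariance.
Variables (R : realType) (N d : nat) (v : 'I_N -> 'rV[R]_d).
Variables (a : 'I_N -> 'I_N -> 'rV[R]_d -> R) (P : trans_fun R N d).
Hypothesis hP : is_process_semigroup v a P.
Hypothesis hac : forall i j, i != j -> continuous (a i j).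
(* [Pi] stands for [f |-> sum_j int f j d(pi j)]. *)
Variable Pi : ('I_N -> 'rV[R]_d -> R) -> R.
Hypothesis Pi_linear : forall f h c, mbstate f -> mbstate h ->
  Pi (fun i l => f i l + c * h i l) = Pi f + c * Pi h.
Hypothesis Pi_bound : forall f M, mbstate f -> (forall i l, `|f i l| <= M) ->
  `|Pi f| <= M.
Implicit Types (s t c e M r u : R) (i j : 'I_N) (l : 'rV[R]_d).
Implicit Types (f h : 'I_N -> 'rV[R]_d -> R).

Local Notation gen := (generator v a).
Local Notation Q := (semigroup P).

Lemma Pi_sub f h : mbstate f -> mbstate h ->
  Pi (fun i l => f i l - h i l) = Pi f - Pi h.
Proof.
move=> mf mh; rewrite -[- Pi h]mulN1r -Pi_linear//; congr Pi.
by apply/funext => i; apply/funext => l; rewrite mulN1r.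
Qed.

Lemma Pi_scale c f : mbstate f -> Pi (fun i l => c * f i l) = c * Pi f.
Proof.
move=> mf; pose z (_ : 'I_N) (_ : 'rV[R]_d) : R := 0.
have mz : mbstate z by move=> i; exact: (@mbounded_cst R _ (Rd R d) 0).
have P0 : Pi z = 0.
  by apply/eqP; rewrite -normr_le0; apply: Pi_bound => // i l; rewrite normr0.
rewrite -[RHS]add0r -P0 -Pi_linear//; congr Pi.
by apply/funext => i; apply/funext => l; rewrite add0r.
Qed.

Lemma invariant_generator :
  (forall t f, 0 <= t -> test_fun f -> Pi (Q t f) = Pi f) ->
  forall f, test_fun f -> Pi (gen f) = 0.
Proof.
move=> inv f tf; apply/eqP; rewrite -normr_le0; apply/ler_addgt0Pr => e e0.
rewrite add0r; have [s s0 Hs] := semigroup_slope hP hac tf e0.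
have mf := test_fun_mbstate tf; have mg := Cc_mbstate (generator_Cc v hac tf).
have mQ := mbstate_semigroup hP (ltW s0) mf.
have : `|Pi (fun i l => (Q s f i l - f i l) - s * gen f i l)| <= e * s.
  apply: Pi_bound.
    by apply: mbstateB; [exact: mbstateB|exact: mbstateZ].
  by move=> i l; apply: Hs; rewrite lexx ltW.
rewrite Pi_sub; [|exact: mbstateB|exact: mbstateZ].
rewrite Pi_sub// Pi_scale// (inv _ _ (ltW s0) tf) subrr sub0r normrN normrM gtr0_norm//.
by rewrite mulrC ler_pM2r.
Qed.

(** The signed measure [w_s] of the overview, as a functional on functions. *)
Definition defect s f : R := Pi (Q s f) - Pi f.

Lemma defect_linear s f h c : 0 <= s -> mbstate f -> mbstate h ->
  defect s (fun i l => f i l + c * h i l) = defect s f + c * defect s h.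
Proof.
move=> s0 mf mh; rewrite /defect Pi_linear// (semigroupD hP)//; last exact: mbstateZ.
rewrite (semigroupZ hP)// Pi_linear; [ring|exact: (mbstate_semigroup hP)..].
Qed.

Lemma defect_bound s f M : 0 <= s -> mbstate f -> (forall i l, `|f i l| <= M) ->
  `|defect s f| <= 2 * M.
Proof.
move=> s0 mf fM; apply: le_trans (ler_normB _ _) _; rewrite mulr_natl mulr2n.
apply: lerD; apply: Pi_bound => //; first exact: (mbstate_semigroup hP).
exact: (semigroup_bound hP).
Qed.

Lemma defect_close s f h e : 0 <= s -> mbstate f -> mbstate h ->
  (forall i l, `|f i l - h i l| <= e) -> `|defect s f - defect s h| <= 2 * e.
Proof.
move=> s0 mf mh fh.
have -> : defect s f - defect s h = defect s (fun i l => f i l - h i l).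
  rewrite -[- defect s h]mulN1r -defect_linear//; congr defect.
  by apply/funext => i; apply/funext => l; rewrite mulN1r.
by apply: defect_bound => //; exact: mbstateB.
Qed.

Lemma Pi_semigroup_incr s dl f h e : 0 <= s -> 0 <= dl -> mbstate f -> mbstate h ->
  (forall i l, `|Q dl f i l - f i l - h i l| <= e) ->
  `|Pi (Q (s + dl) f) - Pi (Q s f) - Pi (Q s h)| <= e.
Proof.
move=> s0 dl0 mf mh H.
have mQ := mbstate_semigroup hP dl0 mf.
have mQf := mbstateB mQ mf.
rewrite (semigroup_comp hP)// -Pi_sub; [|exact: (mbstate_semigroup hP)..].
rewrite -(semigroupB hP)// -Pi_sub; [|exact: (mbstate_semigroup hP)..].
rewrite -(semigroupB hP)//; apply: Pi_bound.
  by apply: (mbstate_semigroup hP) => //; exact: mbstateB.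
by apply: (semigroup_bound hP) => //; exact: mbstateB.
Qed.

(** Since [Pi h = 0], the term [Pi (Q s h)] can be written as [defect s h]. Taking [dl * A f] for
    [h], which is where the weak equation enters, gives the forward equation for the defect; taking
    0 gives its continuity in time. *)
Lemma defect_incr s dl f h e : 0 <= s -> 0 <= dl -> mbstate f -> mbstate h ->
  Pi h = 0 -> (forall i l, `|Q dl f i l - f i l - h i l| <= e) ->
  `|defect (s + dl) f - defect s f - defect s h| <= e.
Proof.
move=> s0 dl0 mf mh Ph H; rewrite /defect Ph subr0 opprB addrA subrK.
exact: Pi_semigroup_incr.
Qed.

Lemma defect_continuous f e : Cc_state f -> 0 < e ->
  exists2 eta, 0 < eta & forall s r, 0 <= s -> 0 <= r -> `|s - r| <= eta ->
    `|defect s f - defect r f| <= e.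
Proof.
move=> Cf e0; have [eta eta0 H] := semigroup_continuous0 hP hac Cf e0.
have mf := Cc_mbstate Cf.
pose z (_ : 'I_N) (_ : 'rV[R]_d) : R := 0.
have mz : mbstate z by move=> i; exact: (@mbounded_cst R _ (Rd R d) 0).
have Pz : Pi z = 0.
  by apply/eqP; rewrite -normr_le0; apply: Pi_bound => // i l; rewrite normr0.
have key s dl : 0 <= s -> 0 <= dl <= eta -> `|defect (s + dl) f - defect s f| <= e.
  move=> s0 /andP[dl0 dle].
  have := @defect_incr s dl f z e s0 dl0 mf mz Pz.
  have -> : defect s z = 0.
    apply/eqP; rewrite -normr_le0 -(mulr0 2); apply: defect_bound => // i l.
    by rewrite normr0.
  rewrite subr0; apply => i l; rewrite subr0; apply: H; exact/andP.
exists eta => // s r s0 r0 sr.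
wlog rs : s r s0 r0 sr / r <= s.
  move=> wl; have [rs|/ltW sr'] := leP r s; first exact: wl.
  by rewrite distrC; apply: wl => //; rewrite distrC.
rewrite -(subrKC r s); apply: key => //.
by rewrite subr_ge0 rs/= (le_trans (ler_norm _)).
Qed.

(** At time 0 the right side of the slope estimate is 0. *)
Lemma semigroup0 f : test_fun f -> Q 0 f = f.
Proof.
move=> tf; apply/funext => j; apply/funext => l; apply/eqP.
have [eta eta0 /(_ 0 j l)] := semigroup_slope hP hac tf ltr01.
rewrite lexx (ltW eta0) => /(_ isT); rewrite mul0r mulr0 subr0 normr_le0.
by rewrite subr_eq0.
Qed.

(** * Free transport, the jump part, and the decay of the defect *)

Definition flow u h : 'I_N -> 'rV[R]_d -> R := fun j l => h j (l + u *: v j).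

Lemma flow0 h : flow 0 h = h.
Proof. by apply/funext => j; apply/funext => l; rewrite /flow scale0r addr0. Qed.

Let V : R := \sum_j `|v j|.

Lemma speed_le j : `|v j| <= V.
Proof. by rewrite /V (bigD1 j)//= lerDl sumr_ge0. Qed.

Lemma flow_supp u h M : 0 <= u -> (forall j l, M < `|l| -> h j l = 0) ->
  forall j l, M + V * u < `|l| -> flow u h j l = 0.
Proof.
move=> u0 hM j l lM; apply: hM.
have : `|u *: v j| <= V * u by rewrite normrZ ger0_norm// mulrC ler_wpM2r// speed_le.
have := ler_normB (l + u *: v j) (u *: v j); rewrite addrK.
by move: lM; lra.
Qed.

Lemma flow_test u h : test_fun h -> test_fun (flow u h).
Proof.
move=> /test_funP[Ch [M hM]]; apply/test_funP; split.
  by move=> j; exact: C1_shift (Ch j).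
exists (M + V * `|u|) => j l lM; apply: hM.
have : `|u *: v j| <= V * `|u| by rewrite normrZ mulrC ler_wpM2r// speed_le.
have := ler_normB (l + u *: v j) (u *: v j); rewrite addrK.
by move: lM; lra.
Qed.

Lemma flow_continuous h e : test_fun h -> 0 < e ->
  exists2 eta, 0 < eta & forall u r, `|u - r| < eta ->
    forall j l, `|flow u h j l - flow r h j l| <= e.
Proof.
move=> /test_funP[Ch [M hM]] e0.
have /choice[eta Heta] : forall j, exists eta : R,
    0 < eta /\ forall x y, `|x - y| < eta -> `|h j x - h j y| <= e.
  move=> j; have [eta ? ?] := supp_unif_continuous (C1_continuous (Ch j)) (hM j) e0.
  by exists eta.
have eta0 : 0 < \big[Num.min/1]_j (eta j / (V + 1)).
  elim/big_ind : _ => // [x y x0 y0|j _]; first by rewrite lt_min x0.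
  by rewrite divr_gt0//; [have [] := Heta j|rewrite ltr_wpDl// sumr_ge0].
exists (\big[Num.min/1]_j (eta j / (V + 1))) => // u r ur j l.
have [_] := Heta j; apply.
rewrite opprD addrACA subrr add0r -scalerBl normrZ.
have : `|u - r| < eta j / (V + 1).
  by apply: lt_le_trans ur _; exact: bigmin_le.
have V1 : 0 < V + 1 by rewrite ltr_wpDl// sumr_ge0.
rewrite ltr_pdivlMr//; apply: le_lt_trans; rewrite ler_wpM2l//.
by apply: le_trans (speed_le j) _; rewrite lerDl.
Qed.

Definition jump h j l : R := \sum_(i < N | i != j) a j i l * (h i l - h j l).

Lemma generatorE h j l : gen h j l = 'D_(v j) (h j) l + jump h j l.
Proof. by []. Qed.

Lemma jump_Cc f : test_fun f -> Cc_state (jump f).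
Proof.
move=> /test_funP[Cf [M fM]]; split=> [j|].
  apply: cts_sum => i ij; apply: ctsM; first by apply: hac; rewrite eq_sym.
  by apply: ctsB; exact: C1_continuous.
exists M => j l lM; rewrite /jump big1// => i _.
by rewrite !fM// subrr mulr0.
Qed.

Lemma transport_Cc f : test_fun f -> Cc_state (fun j => 'D_(v j) (f j)).
Proof.
move=> /test_funP[Cf [M fM]]; split=> [j|]; first by have [_] := Cf j; apply.
by exists M => j l lM; exact: (@derive_supp _ _ _ (v j) _ (fM j) _ lM).
Qed.

(* The rates are only continuous: [jump f] is compared with the test function
   obtained from C^1 approximations of the rates, which has the same support. *)
Lemma jump_defect_bound s rho (A K : R) f : 0 <= s -> 0 <= A -> test_fun f ->
  (forall j i l, i != j -> `|l| <= rho -> `|a j i l| <= A) ->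
  (forall j l, rho < `|l| -> f j l = 0) -> (forall j l, `|f j l| <= 1) ->
  (forall h, test_fun h -> (forall j l, rho < `|l| -> h j l = 0) ->
     (forall j l, `|h j l| <= 1) -> `|defect s h| <= K) ->
  `|defect s (jump f)| <= (2 * N%:R * (A + 1) + 1) * K.
Proof.
(* [C] bounds a sum of at most [N] terms, each a rate of at most [A + 1] times a difference of at
   most 2; the last 1 makes [C] positive, so that one may divide by it. *)
move=> s0 A0 tf aA frho f1 HK; set C := 2 * _ * _ + 1.
have C0 : 0 < C by rewrite ltr_wpDl// !mulr_ge0// addr_ge0.
apply/ler_addgt0Pr => e e0.
(* The bound 1 keeps the approximate rates below [A + 1]. The other bound absorbs the final error
   [4 * N * e']: one factor 2 comes from differences of values of [f], the other from
   [defect_close]. *)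
pose e' := Num.min 1 (e / (4 * N%:R + 1)).
have N1 : 0 < 4 * N%:R + 1 :> R by rewrite ltr_wpDl// mulr_ge0.
have e'0 : 0 < e' by rewrite lt_min ltr01 divr_gt0.
have e'1 : e' <= 1 by rewrite ge_min lexx.
have e'e : e' * (4 * N%:R) <= e.
  apply: (@le_trans _ _ (e' * (4 * N%:R + 1))).
    by apply: ler_wpM2l; [exact: ltW|rewrite lerDl].
  by rewrite -ler_pdivlMr// ge_min lexx orbT.
have /choice[b Hb] : forall ji : 'I_N * 'I_N, exists k, ji.2 != ji.1 ->
    C1 k /\ forall l, `|l| <= rho -> `|k l - a ji.1 ji.2 l| <= e'.
  move=> [j i] /=; case: (boolP (i == j)) => ij; first by exists (cst 0).
  have [|k [Ck Hk _]] := @C1_approx _ _ (a j i) rho e' _ e'0; last by exists k.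
  by apply: hac; rewrite eq_sym.
pose jump' j l := \sum_(i < N | i != j) b (j, i) l * (f i l - f j l).
have f2 i j l : `|f i l - f j l| <= 2.
  by apply: le_trans (ler_normB _ _) _; rewrite -[2]/(1 + 1) lerD.
have sum_le j l (F : 'I_N -> R) (x : R) : 0 <= x -> (forall i, i != j -> `|F i| <= x) ->
    `|\sum_(i < N | i != j) F i| <= N%:R * x.
  move=> x0 Fx; apply: le_trans (ler_norm_sum _ _ _) _.
  apply: (@le_trans _ _ (\sum_(i < N) x)); last first.
    by rewrite sumr_const card_ord mulr_natl.
  by rewrite big_mkcond/=; apply: ler_sum => i _; case: ifP => // ij; exact: Fx.
have [Cf [M fM]] := (test_funP f).1 tf.
have supp' j l : rho < `|l| -> jump' j l = 0.
  by move=> lr; rewrite /jump' big1// => i _; rewrite !frho// subrr mulr0.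
have tj' : test_fun jump'.
  apply/test_funP; split; last by exists rho; exact: supp'.
  move=> j; apply: C1_sum => i ij; apply: C1M; first by have [] := Hb (j, i) ij.
  exact: C1B.
have bound' j l : `|jump' j l| <= C.
  have [lr|lr] := leP `|l| rho; last by rewrite supp'// normr0 ltW.
  apply: (@le_trans _ _ (N%:R * ((A + 1) * 2))); last first.
    rewrite /C (_ : N%:R * ((A + 1) * 2) = 2 * N%:R * (A + 1)); last by ring.
    by rewrite lerDl.
  apply: sum_le => // [|i ij]; first by rewrite mulr_ge0// addr_ge0.
  rewrite normrM ler_pM// -(subrK (a j i l) (b (j, i) l)).
  apply: le_trans (ler_normD _ _) _; rewrite addrC lerD ?aA//.
  by apply: le_trans e'1; have [_] := Hb (j, i) ij; apply.
have close j l : `|jump f j l - jump' j l| <= N%:R * (e' * 2).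
  have [lr|lr] := leP `|l| rho; last first.
    rewrite supp'// subr0 /jump big1 ?normr0 ?mulr_ge0 ?(ltW e'0)// => i _.
    by rewrite !frho// subrr mulr0.
  rewrite /jump /jump' -sumrB; apply: sum_le => // [|i ij].
    by rewrite mulr_ge0// ltW.
  rewrite -mulrBl normrM ler_pM// distrC.
  by have [_] := Hb (j, i) ij; apply.
have mj' := test_fun_mbstate tj'.
have D1 : `|defect s jump'| <= C * K.
  (* In the shape of [defect_linear] this extracts the factor [C], and [C^-1 * jump'] has the
     normalisation that [HK] asks for. *)
  have -> : jump' = fun j l => 0 * jump' j l + C * (C^-1 * jump' j l).
    apply/funext => j; apply/funext => l.
    by rewrite mul0r add0r mulVKf// gt_eqF.
  have mc := mbstateZ C^-1 mj'.
  have zE : defect s (fun j l => 0 * jump' j l) = 0.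
    have m0 := mbstateZ 0 mj'; apply/eqP; rewrite -normr_le0 -[leRHS](mulr0 2).
    by apply: defect_bound => // i l; rewrite mul0r normr0.
  rewrite defect_linear//; last exact: mbstateZ.
  rewrite zE add0r normrM (gtr0_norm C0) ler_pM2l//.
  apply: HK => [|j l lr|j l].
  - apply/test_funP; have [Cj' _] := (test_funP _).1 tj'.
    split=> [j|]; first exact: C1Z.
    by exists rho => j l lr; rewrite supp'// mulr0.
  - by rewrite supp'// mulr0.
  - by rewrite normrM normfV (gtr0_norm C0) mulrC ler_pdivrMr// mul1r.
have D2 := defect_close s0 (Cc_mbstate (jump_Cc tf)) mj' close.
rewrite -[defect s (jump f)](subrK (defect s jump')).
apply: le_trans (ler_normD _ _) _; rewrite [leRHS]addrC lerD//; apply: le_trans D2 _; apply: le_trans e'e.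
by rewrite le_eqVlt; apply/orP; left; apply/eqP; ring.
Qed.

Hypothesis Pi_gen : forall f, test_fun f -> Pi (gen f) = 0.

(** A discrete product rule, with [F = flow (s - r) h]. Moving time with [F] fixed contributes
    [dl * defect r (gen F)]; moving the function at time [r + dl] contributes [- dl] times the
    defect of the transport part of [F], which continuity in time brings back to time [r]. The
    difference of the two is the jump part. The shares of [e] are 1/4, then 1/2 because
    [defect_bound] doubles, then 1/4. *)
Lemma defect_right_slope s r h e : 0 <= r < s -> test_fun h -> 0 < e ->
  exists2 eta, 0 < eta & forall dl, 0 < dl < eta ->
    `|defect (r + dl) (flow (s - (r + dl)) h) - defect r (flow (s - r) h)
      - dl * defect r (jump (flow (s - r) h))| <= e * dl.
Proof.
move=> /andP[r0 rs] th e0; set F := flow (s - r) h.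
have tF : test_fun F by exact: flow_test.
have [CF [M FM]] := (test_funP F).1 tF.
have mF := test_fun_mbstate tF.
have mgF := Cc_mbstate (generator_Cc v hac tF).
have CVF := transport_Cc tF; have mVF := Cc_mbstate CVF.
pose VF j := 'D_(v j) (F j).
have e40 : 0 < e / 4 by rewrite divr_gt0.
have [eta1 eta10 H1] := semigroup_slope hP hac tF e40.
have [eta2 eta20 H2] := defect_continuous CVF e40.
have /choice[eta Heta] : forall j, exists x : R, 0 < x /\ forall u l, `|u| < x ->
    `|F j (l + u *: v j) - F j l - u * 'D_(v j) (F j) l| <= e / 4 * `|u|.
  move=> j; have [x x0 Hx] := @unif_taylor _ _ (F j) (v j) M (e / 4)
    (fun l => C1_derivable (CF j)) ((CF j).2 (v j)) (FM j) e40.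
  by exists x; split=> // u l; exact: Hx.
pose eta3 := \big[Num.min/1]_j eta j.
have eta30 : 0 < eta3.
  rewrite /eta3; elim/big_ind : _ => // [x y x0 y0|j _]; first by rewrite lt_min x0.
  by have [] := Heta j.
exists (Num.min eta1 (Num.min eta2 eta3)); first by rewrite !lt_min eta10 eta20.
move=> dl /andP[dl0]; rewrite !lt_min => /and3P[dl1 dl2 dl3].
have rdl0 : 0 <= r + dl by rewrite addr_ge0// ltW.
pose G := flow (s - (r + dl)) h.
have tG : test_fun G by exact: flow_test.
have mG := test_fun_mbstate tG.
(* Later in time less transport remains, so [G] is [F] transported backwards by [dl]; hence the
   Taylor estimate is used at [- dl]. *)
have GE j l : G j l = F j (l + (- dl) *: v j).
  rewrite /G /F /flow -addrA -scalerDl; congr (h j (l + _ *: _)); ring.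
have S1 : `|defect (r + dl) F - defect r F - dl * defect r (gen F)| <= e / 4 * dl.
  have -> : dl * defect r (gen F) = defect r (fun i l => dl * gen F i l).
    rewrite /defect Pi_scale// (semigroupZ hP)// Pi_scale//; last exact: (mbstate_semigroup hP).
    by rewrite mulrBr.
  apply: defect_incr => //; [exact: ltW|exact: mbstateZ|by rewrite Pi_scale// Pi_gen// mulr0|].
  by move=> i l; apply: H1; rewrite !ltW.
have S2 : `|defect (r + dl) G - defect (r + dl) F + dl * defect (r + dl) VF|
    <= 2 * (e / 4 * dl).
  have -> : defect (r + dl) G - defect (r + dl) F + dl * defect (r + dl) VF =
      defect (r + dl) (fun i l => (G i l + (- 1) * F i l) + dl * VF i l).
    rewrite !defect_linear//; last by apply: mbstateD => //; exact: mbstateZ.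
    by rewrite mulN1r.
  apply: defect_bound => // [|j l].
    by apply: mbstateD; [apply: mbstateD => //; exact: mbstateZ|exact: mbstateZ].
  have [_ /(_ (- dl) l)] := Heta j; rewrite normrN gtr0_norm// GE mulN1r mulNr opprK.
  by apply; apply: lt_le_trans dl3 _; exact: bigmin_le.
have S3 : `|defect (r + dl) VF - defect r VF| <= e / 4.
  by apply: H2 => //; rewrite addrAC subrr add0r gtr0_norm// ltW.
have S4 : defect r (jump F) = defect r (gen F) - defect r VF.
  rewrite -[- defect r VF]mulN1r -defect_linear//; congr defect.
  apply/funext => j; apply/funext => l.
  by rewrite generatorE /VF mulN1r addrAC subrr add0r.
have S3' : `|dl * defect (r + dl) VF - dl * defect r VF| <= e / 4 * dl.
  by rewrite -mulrBr normrM gtr0_norm// mulrC ler_wpM2r// ltW.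
rewrite S4 mulrBr; move: S1 S2 S3'; rewrite -/G -/F.
rewrite !ler_norml => /andP[? ?] /andP[? ?] /andP[? ?].
by apply/andP; split; lra.
Qed.

(* Each iteration gains a factor 1/2, as the weight [expR (2 C s)] grows twice as
   fast as the bound [C] on the jump part. *)
Lemma defect_decay t rho (A : R) : 0 <= t -> 0 <= A ->
  (forall j i l, i != j -> `|l| <= rho + V * t -> `|a j i l| <= A) ->
  forall n s h, 0 <= s <= t -> test_fun h ->
    (forall j l, rho + V * (t - s) < `|l| -> h j l = 0) ->
    (forall j l, `|h j l| <= 1) ->
    `|defect s h| <= 2 * 2^-1 ^+ n * expR (2 * (2 * N%:R * (A + 1) + 1) * s).
Proof.
move=> t0 A0 aA; set C := _ + 1.
have C0 : 0 < C by rewrite ltr_wpDl// !mulr_ge0// addr_ge0.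
have V0 : 0 <= V by exact: sumr_ge0.
elim=> [|n IH] s h /andP[s0 st] th hrho h1.
  rewrite expr0 mulr1; apply: le_trans (_ : 2 * 1 <= _).
    by apply: defect_bound => //; exact: test_fun_mbstate.
  by rewrite ler_pM2l// -expR0 ler_expR !mulr_ge0// ltW.
(* This is the bound claimed at rank [n + 1]. Its derivative [2 * C * psi] equals [C] times the
   bound at rank [n], exactly what the jump part may contribute. *)
pose psi r := 2^-1 ^+ n * expR (2 * C * r).
have -> : 2 * 2^-1 ^+ n.+1 * expR (2 * C * s) = psi s.
  by rewrite /psi exprS mulrA mulfV// mul1r.
have psi_incr r dl : 0 <= dl ->
    dl * (C * (2 * 2^-1 ^+ n * expR (2 * C * r))) <= psi (r + dl) - psi r.
  move=> dl0; rewrite /psi (mulrDr (2 * C) r dl) expRD -mulrBr.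
  have -> : dl * (C * (2 * 2^-1 ^+ n * expR (2 * C * r))) =
     2^-1 ^+ n * (expR (2 * C * r) * (2 * C * dl)) by ring.
  apply: ler_wpM2l; first exact: exprn_ge0.
  rewrite -[X in _ - X]mulr1 -mulrBr ler_wpM2l ?expR_ge0//.
  by rewrite lerBrDl expR_ge1Dx.
have psi_cont : continuous psi.
  move=> r; apply: cvgM; first exact: cvg_cst.
  apply: (continuous_comp _ (@continuous_expR R (2 * C * r))).
  by apply: cvgM; [exact: cvg_cst|exact: cvg_id].
(* A one-sided bound suffices, since [- h] satisfies the same hypotheses as [h]. *)
suff key k : test_fun k -> (forall j l, rho + V * (t - s) < `|l| -> k j l = 0) ->
    (forall j l, `|k j l| <= 1) -> defect s k <= psi s.
  rewrite ler_norml key// andbT lerNl.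
  have mh := test_fun_mbstate th.
  have -> : - defect s h = defect s (fun j l => - h j l).
    have -> : (fun j l => - h j l) = (fun j l => h j l + (-2) * h j l).
      by apply/funext => j; apply/funext => l; ring.
    by rewrite defect_linear//; ring.
  apply: key => [|j l lr|j l]; [|by rewrite hrho// oppr0|by rewrite normrN].
  have [Ch [M hM]] := (test_funP h).1 th; apply/test_funP; split=> [j|].
    rewrite (_ : (fun l => _) = fun l => (-1) * h j l); first exact: C1Z.
    by apply/funext => l; rewrite mulN1r.
  by exists M => j l lM; rewrite hM// oppr0.
move=> tk krho k1.
have psi0 : 0 <= psi 0 by rewrite /psi mulr_ge0 ?exprn_ge0 ?expR_ge0.
(* At the end [r = s] the transported function is [k] itself; at the end [r = 0] the defect vanishes
   because [Q 0] fixes test functions. *)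
suff : defect s (flow (s - s) k) - psi s <= defect 0 (flow (s - 0) k) - psi 0.
  have tfk := flow_test (s - 0) tk.
  by rewrite subrr flow0 [X in _ <= X - _]/defect semigroup0// subrr; lra.
apply: (@right_slope_le0 _ (fun r => defect r (flow (s - r) k) - psi r) s s0).
  move=> r /andP[r0 rs] e e0; have e30 : 0 < e / 3 by rewrite divr_gt0.
  have e60 : 0 < e / 6 by rewrite divr_gt0.
  have tF := flow_test (s - r) tk.
  have [eta1 eta10 H1] := defect_continuous (test_fun_Cc tF) e30.
  have [eta2 eta20 H2] := flow_continuous tk e60.
  have /cvgrPdist_le/(_ _ e30)/nbhs_ballP[eta3 /= eta30 H3] := psi_cont r.
  exists (Num.min eta1 (Num.min eta2 eta3)); first by rewrite !lt_min eta10 eta20.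
  move=> q /andP[q0 qs]; rewrite !lt_min => /and3P[qr1 qr2 qr3].
  have tG := flow_test (s - q) tk.
  have {}H2 : forall j l, `|flow (s - q) k j l - flow (s - r) k j l| <= e / 6.
    by apply: H2; rewrite (_ : _ - _ = r - q); [rewrite distrC|ring].
  have := defect_close q0 (test_fun_mbstate tG) (test_fun_mbstate tF) H2.
  have := H1 q r q0 r0 (ltW qr1).
  have := H3 q; rewrite -ball_normE /= distrC => /(_ qr3).
  by rewrite !ler_norml => /andP[? ?] /andP[? ?] /andP[? ?]; apply/andP; split; lra.
move=> r /andP[r0 rs] e e0.
have [eta eta0 Heta] := @defect_right_slope s r k e (introT andP (conj r0 rs)) tk e0.
exists eta => // dl dlI; have := Heta dl dlI; move/andP: dlI => [dl0 dle].
have sr0 : 0 <= s - r by rewrite subr_ge0 ltW.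
have rt : r <= t by apply: le_trans st; exact: ltW.
set F := flow (s - r) k.
(* Transport over the time [s - r] enlarges the radius [rho + V * (t - s)] by at most
   [V * (s - r)]. *)
have Frho j l : rho + V * (t - r) < `|l| -> F j l = 0.
  move=> lr; apply: (flow_supp sr0 krho); apply: le_lt_trans lr.
  by rewrite -addrA -mulrDr addrA subrK.
have : `|defect r (jump F)| <= C * (2 * 2^-1 ^+ n * expR (2 * C * r)).
  apply: (@jump_defect_bound r (rho + V * (t - r))) => //.
  - exact: flow_test.
  - move=> j i l ij lr; apply: aA => //; apply: le_trans lr _.
    by rewrite lerD2l ler_wpM2l// lerBlDr lerDl.
  - by move=> j l; exact: k1.
  - by move=> q tq qrho q1; apply: IH; rewrite ?r0.
move=> /(le_trans (ler_norm _)) D.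
have := psi_incr r dl (ltW dl0).
have : dl * defect r (jump F) <= dl * (C * (2 * 2^-1 ^+ n * expR (2 * C * r))).
  by rewrite ler_pM2l.
by rewrite ler_norml => D1 D2 /andP[_ D3]; move: D1 D2 D3; lra.
Qed.

Lemma invariant_test t f : 0 <= t -> test_fun f -> Pi (Q t f) = Pi f.
Proof.
move=> t0 tf; have [Cf [M fM]] := (test_funP f).1 tf.
have [B B0 fB] := mbstate_bound (test_fun_mbstate tf).
have /choice[A HA] : forall ji : 'I_N * 'I_N, exists A : R, ji.2 != ji.1 ->
    0 <= A /\ forall l, `|l| <= M + V * t -> `|a ji.1 ji.2 l| <= A.
  move=> [j i] /=; case: (boolP (i == j)) => ij; first by exists 0.
  have [|A A0 HA] := @continuous_ball_bounded _ _ (a j i) (M + V * t); last by exists A.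
  by apply: hac; rewrite eq_sym.
pose A' := \sum_ji `|A ji|.
have A'0 : 0 <= A' by exact: sumr_ge0.
have aA j i l : i != j -> `|l| <= M + V * t -> `|a j i l| <= A'.
  move=> ij lM; have [_ H] := HA (j, i) ij; apply: le_trans (H l lM) _.
  apply: le_trans (ler_norm _) _.
  by rewrite /A' (bigD1 (j, i))//= lerDl sumr_ge0.
have B1 : 0 < B + 1 by rewrite ltr_wpDl.
(* [defect_decay] asks for functions bounded by 1. It is applied at [s = t], where the admissible
   ball has shrunk to radius [M], and the rank is sent to infinity. *)
pose h j l := (B + 1)^-1 * f j l.
have th : test_fun h.
  apply/test_funP; split=> [j|]; first exact: C1Z.
  by exists M => j l lM; rewrite /h fM// mulr0.
have hM j l : M + V * (t - t) < `|l| -> h j l = 0.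
  by rewrite subrr mulr0 addr0 => lM; rewrite /h fM// mulr0.
have h1 j l : `|h j l| <= 1.
  rewrite /h normrM normfV (gtr0_norm B1) mulrC ler_pdivrMr// mul1r.
  by apply: le_trans (fB j l) _; rewrite lerDl.
have mf := test_fun_mbstate tf; have mh := test_fun_mbstate th.
have d0 : defect t h = 0.
  apply/eqP; rewrite -normr_le0.
  have H n tI := @defect_decay t M A' t0 A'0 aA n t h tI th hM h1.
  have tt : 0 <= t <= t by rewrite t0 lexx.
  have {}H := H ^~ tt.
  set E := expR _ in H.
  have cv : (fun n => 2 * 2^-1 ^+ n * E) @ \oo --> (0 : R).
    rewrite -(mul0r E); apply: cvgM; last exact: cvg_cst.
    rewrite -[X in _ --> X](mulr0 2); apply: cvgM; first exact: cvg_cst.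
    by apply: cvg_expr; rewrite ger0_norm// invf_lt1// ltr1n.
  rewrite -(cvg_lim (@Rhausdorff R) cv); apply: limr_ge; first by apply: cvgP cv.
  by near=> n; exact: H.
apply/eqP; rewrite -subr_eq0; apply/eqP; move: d0; rewrite /defect.
have -> : h = fun j l => (B + 1)^-1 * f j l by [].
rewrite (semigroupZ hP)// !Pi_scale//; last exact: (mbstate_semigroup hP).
by rewrite -mulrBr => /eqP; rewrite mulf_eq0 invr_eq0 gt_eqF//= => /eqP.
Unshelve. all: by end_near. Qed.

End invariance.
(** * From test functions to Borel sets *)

Lemma Rintegral_dominated_cvg (R : realType) d (T : measurableType d)
  (mu : {measure set T -> \bar R}) (F : nat -> T -> R) (f G : T -> R) :
  (forall n, measurable_fun setT (F n)) -> measurable_fun setT f ->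
  mu.-integrable setT (EFin \o G) -> (forall n x, `|F n x| <= G x) ->
  (forall x, F n x @[n --> \oo] --> f x) ->
  Rintegral mu setT (F n) @[n --> \oo] --> Rintegral mu setT f.
Proof.
move=> mF mf iG FG Ff.
have [|||||iF _ H] := @dominated_convergence _ _ _ mu setT measurableT
  (fun n x => (F n x)%:E) (fun x => (f x)%:E) (EFin \o G).
- by move=> n; exact/measurable_EFinP.
- exact/measurable_EFinP.
- by apply: aeW => x _; apply: cvg_EFin; [exact: nearW|exact: Ff].
- exact: iG.
- by apply: aeW => x n _; rewrite /= lee_fin.
apply: fine_cvg; rewrite fineK; first exact: H.
exact: integrable_fin_num.
Qed.

Section functional.
Variables (R : realType) (N d : nat) (D : ('I_N -> 'rV[R]_d -> R) -> R).
Hypothesis D_linear : forall f h c, mbstate f -> mbstate h ->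
  D (fun i l => f i l + c * h i l) = D f + c * D h.
Hypothesis D_cvg : forall (F : nat -> 'I_N -> 'rV[R]_d -> R) f (M : R),
  (forall n, mbstate (F n)) -> mbstate f -> (forall n i l, `|F n i l| <= M) ->
  (forall i l, F n i l @[n --> \oo] --> f i l) -> D (F n) @[n --> \oo] --> D f.
Implicit Types (i j : 'I_N) (l : 'rV[R]_d) (u : 'rV[R]_d -> R).

(** With [\1_B] for [u], this is the indicator of [{i} x B]. *)
Definition at_state i u j l : R := if j == i then u l else 0.

Lemma mbstate_at i u : mbounded (u : Rd R d -> R) -> mbstate (at_state i u).
Proof.
by move=> mu j; rewrite /at_state; case: eqP => _ //; exact: (@mbounded_cst R _ (Rd R d) 0).
Qed.

Lemma at_stateD i u1 u2 c : at_state i (fun l => u1 l + c * u2 l) =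
  (fun j l => at_state i u1 j l + c * at_state i u2 j l).
Proof.
by apply/funext => j; apply/funext => l; rewrite /at_state; case: eqP => _ //; ring.
Qed.

Lemma D_cvg0 (F : nat -> 'I_N -> 'rV[R]_d -> R) f (M : R) :
  (forall n, mbstate (F n)) -> mbstate f -> (forall n i l, `|F n i l| <= M) ->
  (forall i l, F n i l @[n --> \oo] --> f i l) -> (forall n, D (F n) = 0) -> D f = 0.
Proof.
move=> mF mf FM Ff DF; have := D_cvg mF mf FM Ff.
under eq_fun do rewrite DF.
by move=> /(cvg_lim (@Rhausdorff R)) <-; rewrite lim_cst.
Qed.

Lemma zero_mbstate : (forall i (B : set (Rd R d)), measurable B -> D (at_state i \1_B) = 0) ->
  forall f, mbstate f -> D f = 0.
Proof.
move=> H0.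
have Hi i u : mbounded (u : Rd R d -> R) -> D (at_state i u) = 0.
  move: u; apply: (@mbounded_ind R _ (Rd R d) (fun u => D (at_state i u) = 0))
    => [A mA|f h c mf mh Cf Ch|u mu H].
    exact: H0.
    by rewrite at_stateD D_linear ?Cf ?Ch ?mulr0 ?addr0//; exact: mbstate_at.
  have /choice[F HF] : forall n : nat, exists h, [/\ mbounded (h : Rd R d -> R),
      D (at_state i h) = 0 & forall x, `|u x - h x| <= n.+1%:R^-1].
    by move=> n; apply: H; rewrite invr_gt0.
  have [_ [M uM]] := mu.
  apply: (@D_cvg0 (fun n => at_state i (F n)) _ (M + 1)).
  - by move=> n; apply: mbstate_at; have [] := HF n.
  - exact: mbstate_at.
  - move=> n j l; rewrite /at_state; case: eqP => _; last first.
      by rewrite normr0 addr_ge0// (le_trans _ (uM l)).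
    rewrite -[F n l](subrK (u l)) addrC; apply: le_trans (ler_normD _ _) _.
    rewrite lerD// distrC; have [_ _ /(_ l)/le_trans] := HF n; apply.
    by rewrite invf_le1// ler1n.
  - move=> j l; rewrite /at_state; case: eqP => _; last exact: cvg_cst.
    apply/cvgrPdist_le => /= e e0; near=> n.
    have [_ _ /(_ l)/le_trans] := HF n; apply.
    by apply: ltW; near: n; exact: (near_infty_natSinv_lt (PosNum e0)).
  - by move=> n; have [] := HF n.
move=> f mf.
have Hr (r : seq 'I_N) : let S := fun j l => \sum_(i <- r) at_state i (f i) j l in
    mbstate S /\ D S = 0.
  elim: r => [|i r [mS DS]] /=.
    have -> : (fun j l => \sum_(i <- [::]) at_state i (f i) j l) = fun _ _ => 0 : R.
      by apply/funext => j; apply/funext => l; rewrite big_nil.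
    have m0 : mbstate (fun (_ : 'I_N) (_ : 'rV[R]_d) => 0 : R).
      by move=> j; exact: (@mbounded_cst R _ (Rd R d) 0).
    split=> //; have := @D_linear _ _ (-1) m0 m0.
    have -> : (fun (_ : 'I_N) (_ : 'rV[R]_d) => 0 + -1 * 0 : R) = fun _ _ => 0.
      by apply/funext => j; apply/funext => l; ring.
    by move=> ->; ring.
  have -> : (fun j l => \sum_(i' <- i :: r) at_state i' (f i') j l) =
      fun j l => at_state i (f i) j l + 1 * \sum_(i <- r) at_state i (f i) j l.
    by apply/funext => j; apply/funext => l; rewrite big_cons mul1r.
  have mi := mbstate_at i (mf i).
  split; last by rewrite (D_linear _ mi mS) DS Hi// mulr0 addr0.
  by apply: mbstateD => //; exact: mbstateZ.
have [_] := Hr (index_enum 'I_N).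
suff -> : (fun j l => \sum_i at_state i (f i) j l) = f by [].
apply/funext => j; apply/funext => l; rewrite (bigD1 j)//= /at_state eqxx.
by rewrite big1 ?addr0// => i /negbTE; rewrite eq_sym => ->.
Unshelve. all: by end_near. Qed.

(** The indicator of [U] is a bounded pointwise limit of test functions [u n]. Outside [U] every
    [b m] vanishes, so [u n] is 0. At a point of [U] some factor [1 - b m] is below 1, so the [n]-th
    power of the product tends to 0. *)
Lemma zero_open : (forall f, test_fun f -> D f = 0) ->
  forall i (U : set (Rd R d)), open (U : set 'rV[R]_d) -> D (at_state i \1_U) = 0.
Proof.
move=> Dt i U oU; have [A [q [r [r0 UE]]]] := open_bigcup_balls oU.
(* Dividing by [1 + bump] brings the values below 1 and keeps both the C^1 regularity and the set of
   positivity. *)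
pose b m l : R := if m \in A then bump (q m) (r m) l / (1 + bump (q m) (r m) l) else 0.
have bp m l : 0 < 1 + bump (q m) (r m) l by rewrite ltr_wpDr// bump_ge0.
have b01 m l : 0 <= b m l <= 1.
  rewrite /b; case: ifP => _; last by rewrite lexx ler01.
  rewrite divr_ge0 ?bump_ge0 ?(ltW (bp _ _))//=.
  by rewrite ler_pdivrMr// mul1r lerDr.
have Cb m : C1 (b m).
  rewrite /b; case: (m \in A); last exact: C1_cst.
  apply: C1M; first exact: C1_bump.
  apply: C1V => [l|]; first by rewrite gt_eqF.
  by apply: C1D; [exact: C1_cst|exact: C1_bump].
pose u n l : R := 1 - (\prod_(m < n) (1 - b m l)) ^+ n.
have P01 n l : 0 <= \prod_(m < n) (1 - b m l) <= 1.
  have H m : 0 <= 1 - b m l <= 1.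
    by have /andP[? ?] := b01 m l; rewrite subr_ge0 lerBlDr lerDl; apply/andP.
  by apply/andP; split; [apply: prodr_ge0 => m _; have /andP[] := H m|apply: prodr_ile1 => m _; exact: H].
have u01 n l : 0 <= u n l <= 1.
  have /andP[p0 p1] := P01 n l.
  by rewrite /u subr_ge0 exprn_ile1//= lerBlDr lerDl exprn_ge0.
have tu n : test_fun (at_state i (u n)).
  apply/test_funP; split=> [j|].
    rewrite /at_state; case: eqP => _; last exact: C1_cst.
    apply: C1B; first exact: C1_cst.
    by apply: C1X; apply: C1_prod => m _; apply: C1B => //; exact: C1_cst.
  exists (\sum_(m < n) (`|q m| + r m)) => j l lM.
  rewrite /at_state; case: eqP => // _; rewrite /u big1 ?expr1n ?subrr// => m _.
  rewrite /b; case: ifP => _; last by rewrite subr0.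
  rewrite bump_eq0 ?mul0r ?subr0//.
  have : `|q m| + r m < `|l|.
    apply: le_lt_trans lM; rewrite (bigD1 m)//= lerDl; apply: sumr_ge0 => m' _.
    by rewrite addr_ge0// ltW.
  have := ler_normB l (l - q m); rewrite subKr.
  have := ler_normD (l - q m) (q m); rewrite subrK; lra.
have mU : measurable U by exact: open_measurable_Rd.
apply: (@D_cvg0 (fun n => at_state i (u n)) _ 1) => [n||n j l|j l|n].
- exact: test_fun_mbstate.
- by apply: mbstate_at; exact: mbounded_indic.
- rewrite /at_state; case: eqP => _; last by rewrite normr0.
  by have /andP[? ?] := u01 n l; rewrite ger0_norm.
- rewrite /at_state; case: eqP => _; last exact: cvg_cst.
  rewrite indicE; case: (boolP (l \in U)) => [/set_mem|/negP lU]; last first.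
    rewrite (_ : (fun n => u n l) = fun=> 0); first exact: cvg_cst.
    apply/funext => n; rewrite /u big1 ?expr1n ?subrr// => m _.
    rewrite /b; case: ifP => mA; last by rewrite subr0.
    rewrite bump_eq0 ?mul0r ?subr0// leNgt; apply/negP => lq; apply: lU.
    by apply/mem_set; rewrite UE; exists m => //; exact: set_mem.
  rewrite {1}UE => -[m0 Am0 /= lm0].
  have bm0 : 0 < b m0 l.
    by rewrite /b mem_set// divr_gt0// bump_gt0.
  rewrite -[X in _ --> X]subr0; apply: cvgB; first exact: cvg_cst.
  have /andP[_ bm1] := b01 m0 l.
  apply: (@squeeze_cvgr _ _ _ _ (fun=> 0) (fun n => (1 - b m0 l) ^+ n)).
  + near=> n; have /andP[p0 p1] := P01 n l; rewrite exprn_ge0//=.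
    apply: lerXn2r; rewrite ?nnegrE ?subr_ge0//.
    have m0n : (m0 < n)%N by near: n; exists m0.+1.
    rewrite (bigD1 (Ordinal m0n))//=; apply: ler_piMr; first by rewrite subr_ge0.
    apply: prodr_ile1 => m _.
    by have /andP[? ?] := b01 m l; rewrite subr_ge0 lerBlDr lerDl; apply/andP.
  + exact: cvg_cst.
  + by apply: cvg_expr; rewrite ger0_norm ?subr_ge0// ltrBlDr ltrDl.
- exact: Dt.
Unshelve. all: by end_near. Qed.

(** A pi-lambda argument: open sets are stable under intersection and generate the Borel sets, while
    linearity handles complements and bounded convergence handles disjoint unions. *)
Lemma zero_measurable : (forall f, test_fun f -> D f = 0) ->
  forall i (B : set (Rd R d)), measurable B -> D (at_state i \1_B) = 0.
Proof.
move=> Dt i B mB.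
have D1 : D (at_state i \1_setT) = 0 by apply: zero_open => //; exact: openT.
apply: (@dynkin_induction _ (Rd R d) (@open 'rV[R]_d : set (set (Rd R d)))
  (fun A => D (at_state i \1_A) = 0)) => //.
- by move=> U W oU oW; exact: openI.
- by move=> U oU; exact: zero_open.
- move=> A mA DA.
  have -> : (\1_(~` A) : 'rV[R]_d -> R) = fun l => \1_setT l + (-1) * \1_A l.
    apply/funext => l; rewrite !indicE in_setC in_setT.
    by case: (l \in A); rewrite /=; ring.
  rewrite at_stateD D_linear ?D1 ?DA ?mulr0 ?addr0//;
    by apply: mbstate_at; exact: mbounded_indic.
- move=> F mF tF DF.
  pose S n l : R := \sum_(k < n) \1_(F k) l.
  (* By disjointness at most one term of the sum is nonzero, so the partial sums stay bounded by
     1. *)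
  have SE n l k : F k l -> S n l = (k < n)%N%:R.
    move=> Fkl; rewrite /S (eq_bigr (fun k' : 'I_n => (k' == k :> nat)%:R)); last first.
      move=> k' _; rewrite indicE; case: eqP => [->|k'k]; first by rewrite mem_set.
      rewrite memNset//= => Fk'l; apply: k'k.
      by apply: (tF k' k) => //; exists l.
    case: ltnP => kn; last first.
      by rewrite big1// => k' _; rewrite ltn_eqF// (leq_trans _ kn).
    rewrite (bigD1 (Ordinal kn))//= eqxx big1 ?addr0// => k' /negbTE.
    by rewrite -val_eqE/= => ->.
  have S0 n l : ~ (\bigcup_k F k) l -> S n l = 0.
    move=> Fl; rewrite /S big1// => k _; rewrite indicE memNset// => Fkl.
    by apply: Fl; exists k.
  have mS n : mbounded (S n : Rd R d -> R).
    by apply: mbounded_sum => k _; exact: mbounded_indic.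
  have DS n : D (at_state i (S n)) = 0.
    elim: n => [|n IH].
      have -> : S 0%N = fun l => \1_setT l + (-1) * \1_setT l.
        by apply/funext => l; rewrite /S big_ord0; ring.
      rewrite at_stateD D_linear ?D1 ?mulr0 ?addr0//;
      by apply: mbstate_at; exact: mbounded_indic.
    have -> : S n.+1 = fun l => S n l + 1 * \1_(F n) l.
      by apply/funext => l; rewrite /S big_ord_recr/= mul1r.
    rewrite at_stateD D_linear ?IH ?DF ?mulr0 ?addr0//; apply: mbstate_at => //.
    exact: mbounded_indic.
  apply: (@D_cvg0 (fun n => at_state i (S n)) _ 1) => // [n||n j l|j l].
  + exact: mbstate_at.
  + by apply: mbstate_at; apply: mbounded_indic; exact: bigcupT_measurable.
  + rewrite /at_state; case: eqP => _; last by rewrite normr0.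
    have [[k _ Fkl]|Fl] := pselect ((\bigcup_k F k) l); last by rewrite S0// normr0.
    by rewrite (SE n l k)//; case: (k < n)%N; rewrite ?normr1 ?normr0.
  + rewrite /at_state; case: eqP => _; last exact: cvg_cst.
    rewrite indicE; have [Fl|Fl] := pselect ((\bigcup_k F k) l).
      rewrite mem_set//; have [k _ Fkl] := Fl.
      apply: cvg_near_cst; near=> n; rewrite (SE n l k)//.
      have -> // : (k < n)%N by near: n; exists k.+1.
    rewrite memNset//; rewrite (_ : (fun n => S n l) = fun=> 0); first exact: cvg_cst.
    by apply/funext => n; rewrite S0.
Unshelve. all: by end_near. Qed.

End functional.
(** * Weak directional derivatives *)

Definition Cc (R : realType) d (u : 'rV[R]_d -> R) : Prop :=
  continuous u /\ exists M : R, forall l, M < `|l| -> u l = 0.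

Section Cc_integral.
Variables (R : realType) (d : nat).
Variable mu : {sigma_finite_measure set (Rd R d) -> \bar R}.
Hypothesis hmu : is_lebesgue_Rd mu.
Implicit Types (u h phi G : 'rV[R]_d -> R) (l w : 'rV[R]_d) (c s e M : R).

Definition leb u : R := Rintegral mu setT (u : Rd R d -> R).

Lemma CcM u h : continuous u -> Cc h -> Cc (fun l => u l * h l).
Proof.
move=> cu [ch [M hM]]; split; first exact: ctsM.
by exists M => l lM; rewrite hM// mulr0.
Qed.

Lemma CcD u h : Cc u -> Cc h -> Cc (fun l => u l + h l).
Proof.
move=> [cu [M uM]] [ch [K hK]]; split; first exact: ctsD.
by exists (Num.max M K) => l; rewrite gt_max => /andP[? ?]; rewrite uM// hK// addr0.
Qed.

Lemma CcZ c u : Cc u -> Cc (fun l => c * u l).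
Proof. by move=> Cu; apply: CcM => //; exact: cst_continuous. Qed.

Lemma CcB u h : Cc u -> Cc h -> Cc (fun l => u l - h l).
Proof.
move=> Cu Ch; rewrite (_ : (fun l => _) = fun l => u l + (-1) * h l).
  by apply: CcD => //; exact: CcZ.
by apply/funext => l; rewrite mulN1r.
Qed.

Lemma Cc_shift w u : Cc u -> Cc (fun l => u (l + w)).
Proof.
move=> [cu [M uM]]; split; first exact: continuous_shift_arg.
exists (M + `|w|) => l lM; apply: uM.
by have := ler_normB (l + w) w; rewrite addrK; move: lM; lra.
Qed.

(** Supports lie in closed balls whereas [is_lebesgue_Rd] measures open balls of positive radius;
    radius [M + 1] covers the closed ball of radius [M], also when [M = 0]. *)
Definition ball_vol M : R := fine (mu [set l : 'rV[R]_d | `|l| < M + 1]).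

Lemma ball_vol_fin M : 0 <= M -> (mu [set l : 'rV[R]_d | (`|l| < M + 1)%R] < +oo)%E.
Proof.
move=> M0; have [_ /(_ 0 (M + 1)) H _] := hmu.
have /H/andP[_] : 0 < M + 1 by rewrite ltr_wpDl.
by under eq_set do rewrite subr0.
Qed.

Lemma open_norm_lt M : open [set l : 'rV[R]_d | `|l| < M].
Proof.
have := @open_ball_rV R d 0 M.
by under eq_set do rewrite subr0.
Qed.

Lemma cst_integrable (A : set (Rd R d)) c : measurable A -> (mu A < +oo)%E ->
  mu.-integrable A (EFin \o cst c).
Proof.
move=> mA Aoo; apply: measurable_bounded_integrable => //.
exists `|c|; split; first exact: num_real.
by move=> K /ltW cK x _.
Qed.

Lemma Cc_integrable u : Cc u -> mu.-integrable setT (EFin \o (u : Rd R d -> R)).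
Proof.
move=> [cu [M uM]].
have [B B0 uB] := supp_bounded cu uM.
have mu' := continuous_measurable_Rd cu.
have mA : measurable ([set l : 'rV[R]_d | `|l| < `|M| + 1] : set (Rd R d)).
  by apply: open_measurable_Rd; exact: open_norm_lt.
apply: (@le_integrable _ _ _ mu setT measurableT _
  (fun l : Rd R d => (B * \1_([set l : 'rV[R]_d | `|l| < `|M| + 1] : set (Rd R d)) l)%:E)).
- exact/measurable_EFinP.
- move=> l _; rewrite /= lee_fin indicE; case: (boolP (l \in _)) => [_|/negP lA].
    by rewrite mulr1 (ger0_norm B0).
  rewrite uM ?normr0 ?mulr0//.
  have : ~ (`|l : 'rV[R]_d| < `|M| + 1) by move=> lM; apply: lA; apply/mem_set.
  move/negP; rewrite -leNgt; apply: lt_le_trans.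
  by apply: le_lt_trans (ler_norm _) _; rewrite ltrDl.
- apply: (@integrableZl _ _ _ mu setT measurableT B (fun l => (\1__ l)%:E)).
  apply/integrableP; split; first by apply/measurable_EFinP; exact: measurable_indic.
  under eq_integral do rewrite /= ger0_norm ?indicE ?ler0n// -indicE.
  by rewrite integral_indic// setIT; exact: ball_vol_fin.
Qed.

Lemma leb_linear u h c : Cc u -> Cc h -> leb (fun l => u l + c * h l) = leb u + c * leb h.
Proof.
move=> Cu Ch; have iu := Cc_integrable Cu; have ih := Cc_integrable Ch.
have ich := Cc_integrable (CcZ c Ch).
by rewrite /leb (RintegralD measurableT iu ich) (RintegralZl _ measurableT ih).
Qed.

Lemma leb_sub u h : Cc u -> Cc h -> leb (fun l => u l - h l) = leb u - leb h.
Proof.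
move=> Cu Ch; rewrite -[- leb h]mulN1r -leb_linear//; congr leb.
by apply/funext => l; rewrite mulN1r.
Qed.

Lemma leb_scale u c : Cc u -> leb (fun l => c * u l) = c * leb u.
Proof. by move=> Cu; exact: RintegralZl measurableT (Cc_integrable Cu). Qed.

Lemma leb_le u h : Cc u -> Cc h -> (forall l, u l <= h l) -> leb u <= leb h.
Proof.
move=> Cu Ch uh; apply: le_Rintegral => //; exact: Cc_integrable.
Qed.

Lemma leb_bound u M e : 0 <= M -> Cc u -> (forall l, M < `|l| -> u l = 0) ->
  (forall l, `|u l| <= e) -> `|leb u| <= e * ball_vol M.
Proof.
move=> M0 Cu uM ue; have iu := Cc_integrable Cu.
have e0 : 0 <= e := le_trans (normr_ge0 _) (ue 0).
have mA : measurable ([set l : 'rV[R]_d | `|l| < M + 1] : set (Rd R d)).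
  by apply: open_measurable_Rd; exact: open_norm_lt.
have -> : leb u = Rintegral mu [set l : 'rV[R]_d | `|l| < M + 1] u.
  rewrite Rintegral_mkcond; apply: eq_Rintegral => l _.
  rewrite patchE; case: ifPn => // /negP lA; apply: uM.
  have : ~ (`|l : 'rV[R]_d| < M + 1) by move=> lM; apply: lA; apply/mem_set.
  by move/negP; rewrite -leNgt; apply: lt_le_trans; rewrite ltrDl.
have iuA : mu.-integrable [set l : 'rV[R]_d | `|l| < M + 1] (EFin \o u).
  by apply: integrableS iu.
apply: le_trans; first exact: le_normr_Rintegral.
rewrite /ball_vol -(Rintegral_cst mu mA); apply: le_Rintegral => //.
- by move/integrable_abse : iuA.
- by apply: cst_integrable => //; exact: ball_vol_fin.
Qed.

(** Translation invariance is available for nonnegative functions, hence it is applied to the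
    positive and negative parts. *)
Lemma leb_shift w u : Cc u -> leb (fun l => u (l + w)) = leb u.
Proof.
move=> [cu _]; rewrite /leb /Rintegral; congr fine.
have mU := continuous_measurable_Rd cu.
have [_ _ T] := hmu.
rewrite integralE [in RHS]integralE; congr (_ - _)%E.
- under eq_integral do rewrite funeposE; under [RHS]eq_integral do rewrite funeposE.
  apply: (T w (fun l : Rd R d => Order.max (u l)%:E 0)%E); last by move=> x; rewrite le_max lexx orbT.
  under eq_fun do rewrite -[Order.max _ _](funeposE (EFin \o (u : Rd R d -> R))).
  by apply: measurable_funepos; exact/measurable_EFinP.
- under eq_integral do rewrite funenegE; under [RHS]eq_integral do rewrite funenegE.
  apply: (T w (fun l : Rd R d => Order.max (- (u l)%:E) 0)%E); last by move=> x; rewrite le_max lexx orbT.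
  under eq_fun do rewrite -[Order.max _ _](funenegE (EFin \o (u : Rd R d -> R))).
  by apply: measurable_funeneg; exact/measurable_EFinP.
Qed.

Lemma Cc_bump (q : 'rV[R]_d) (r : R) : 0 < r -> Cc (bump q r).
Proof.
move=> r0; split; first exact: C1_continuous (C1_bump q r).
exists (`|q| + r) => l lqr; apply: bump_eq0 => //.
have := ler_normD (l - q) q; rewrite subrK; move: lqr; lra.
Qed.

(** By continuity the bump exceeds half its central value on a small ball, and that ball has
    positive measure. *)
Lemma leb_bump_gt0 (q : 'rV[R]_d) (r : R) : 0 < r -> 0 < leb (bump q r).
Proof.
move=> r0; have b0 : 0 < bump q r q by rewrite bump_gt0// subrr normr0.
have b20 : 0 < bump q r q / 2 by rewrite divr_gt0.
have /cvgrPdist_lt/(_ _ b20)/nbhs_ballP[r' /= r'0 Hr'] := C1_continuous (C1_bump q r) (x := q).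
pose A := [set l : 'rV[R]_d | `|l - q| < r'] : set (Rd R d).
have mA : measurable A by apply: open_measurable_Rd; exact: open_ball_rV.
have [_ /(_ q r' r'0)/andP[A0 Aoo] _] := hmu.
apply: (@lt_le_trans _ _ (bump q r q / 2 * fine (mu A))).
  by rewrite mulr_gt0// fine_gt0// A0.
rewrite -(Rintegral_cst mu mA) Rintegral_mkcond /leb; apply: le_Rintegral => //.
- have -> : EFin \o (cst (bump q r q / 2)) \_ A = (EFin \o cst (bump q r q / 2)) \_ A.
    by apply/funext => x /=; rewrite !patchE; case: ifP.
  by apply/(integrable_mkcond _ mA); exact: cst_integrable.
- exact: Cc_integrable (Cc_bump q r0).
- move=> l _; rewrite patchE; case: ifPn => [/set_mem lA|_]; last exact: bump_ge0.
  have := Hr' l; rewrite -ball_normE /= (distrC q l) => /(_ lA).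
  by rewrite -[leRHS]/(bump q r l) ltr_norml => /andP[_]; lra.
Qed.

(* The integral of [l |-> h (l + s w)] does not depend on [s], and its
   derivative at [s = 0] is the integral of ['D_w h]. *)
Lemma leb_derive w h : (forall l, derivable h l w) -> continuous ('D_w h) -> Cc h ->
  leb ('D_w h) = 0.
Proof.
move=> dh cdh Ch; have [ch [M0 hM0]] := Ch.
pose M := `|M0|.
have hM l : M < `|l| -> h l = 0 by move=> /(le_lt_trans (ler_norm M0)); exact: hM0.
have CD : Cc ('D_w h) by split=> //; exists M; exact: derive_supp.
have Mw0 : 0 <= M + `|w| by exact: addr_ge0 (normr_ge0 _) (normr_ge0 _).
have K0 : 0 <= ball_vol (M + `|w|) by apply: fine_ge0; exact: measure_ge0.
apply/eqP; rewrite -normr_le0; apply/ler_addgt0Pr => e e0; rewrite add0r.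
have e'0 : 0 < e / (ball_vol (M + `|w|) + 1) by rewrite divr_gt0// ltr_wpDl.
have [eta eta0 H] := unif_taylor dh cdh hM e'0.
(* The bound [s <= 1] keeps all supports inside the fixed ball of radius [M + |w|], whose volume
   entered the choice of the error. *)
pose s := Num.min 1 (eta / 2).
have s0 : 0 < s by rewrite lt_min ltr01 divr_gt0.
have s1 : s <= 1 by rewrite ge_min lexx.
have se : `|s| < eta.
  rewrite gtr0_norm//; apply: (@le_lt_trans _ _ (eta / 2)); first by rewrite ge_min lexx orbT.
  by rewrite ltr_pdivrMr// ltr_pMr// ltr1n.
have Cs := Cc_shift (s *: w) Ch.
have Cd := CcB Cs Ch.
have Csd := CcZ s CD.
have E : leb (fun l => (h (l + s *: w) - h l) - s * 'D_w h l) = - (s * leb ('D_w h)).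
  by rewrite leb_sub// leb_sub// leb_shift// subrr sub0r leb_scale.
have : `|leb (fun l => (h (l + s *: w) - h l) - s * 'D_w h l)| <=
    (e / (ball_vol (M + `|w|) + 1) * s) * ball_vol (M + `|w|).
  apply: leb_bound => //; first exact: CcB.
    move=> l lM; have lM' : M < `|l| by apply: le_lt_trans lM; rewrite lerDl.
    rewrite (@derive_supp _ _ _ w _ hM _ lM') (hM l lM') hM ?mulr0 ?subrr//.
    have : `|s *: w| <= `|w| by rewrite normrZ gtr0_norm// ler_piMl.
    have := ler_normB (l + s *: w) (s *: w); rewrite addrK; move: lM; lra.
  by move=> l; have := H s l se; rewrite (gtr0_norm s0).
rewrite E normrN normrM (gtr0_norm s0) mulrAC [leRHS]mulrC ler_pM2l// => /le_trans; apply.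
have K1 : 0 < ball_vol (M + `|w|) + 1 by rewrite ltr_wpDl.
by rewrite mulrAC ler_pdivrMr// ler_pM2l// lerDl.
Qed.

(* With [phi] a bump at [l0], [Phi s := leb (G * phi (. - s w))] has derivative
   [leb (c * phi (. - s w))], hence increases at most at rate about [c l0],
   whereas its increment is [leb ((G (. + t w) - G) * phi)]. *)
Lemma weak_derive_le w (G k : 'rV[R]_d -> R) l0 : continuous G -> continuous k ->
  derivable G l0 w ->
  (forall phi, C1 phi -> Cc phi -> leb (fun l => G l * 'D_w phi l + k l * phi l) = 0) ->
  'D_w G l0 <= k l0.
Proof.
move=> cG ck dG weak; rewrite leNgt; apply/negP => kD.
(* The gap is spent in stages: the difference quotient of [G] at [l0] exceeds [k l0 + 3 * eta],
   around [l0] it still exceeds [k l0 + 2 * eta], and [k] stays below [k l0 + eta]. *)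
pose eta := ('D_w G l0 - k l0) / 4.
have eta0 : 0 < eta by rewrite divr_gt0// subr_gt0.
have etaE : 'D_w G l0 = k l0 + 4 * eta by rewrite /eta mulrC divfK// subrKC.
have /cvgrPdist_lt/(_ _ eta0)/nbhs_ballP[r0 /= r00 Hr0] := ck l0.
have [t [t0 tw Gt]] : exists t : R, [/\ 0 < t, t * `|w| < r0 / 2 &
    t * (k l0 + 3 * eta) < G (l0 + t *: w) - G l0].
  have /cvgrPdist_lt/(_ _ eta0) := dG.
  rewrite -[lim _]/('D_w G l0) => /nbhs_ballP[h0 /= h00 Hh0].
  (* The shift by [t *: w] has length below [r0 / 2]; as the bump radius is at most [r0 / 2], every
     [phis s] with [0 <= s <= t] lives where [k] is controlled. *)
  pose t := Num.min (h0 / 2) (r0 / 4 / (`|w| + 1)).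
  have w1 : 0 < `|w| + 1 by rewrite ltr_wpDl.
  have t0 : 0 < t by rewrite lt_min !divr_gt0.
  exists t; split=> //.
    have : t <= r0 / 4 / (`|w| + 1) by rewrite ge_min lexx orbT.
    rewrite ler_pdivlMr// mulrDr mulr1; move: t0 r00; lra.
  have := Hh0 t; rewrite -ball_normE /= sub0r normrN gtr0_norm// => /(_ _ _).
  rewrite gt_eqF// => /(_ _ isT).
  have -> : t < h0 by rewrite gt_min ltr_pdivrMr// ltr_pMr// ltr1n.
  move=> /(_ isT); rewrite ltr_norml => /andP[_].
  rewrite -[t^-1 *: _]/(t^-1 * _) [t *: w + l0]addrC etaE => H.
  by rewrite -ltr_pdivlMl//; move: H; lra.
pose K l := G (l + t *: w) - G l.
have cK : continuous K by apply: ctsB => //; exact: continuous_shift_arg.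
have Kl0 : 0 < K l0 - t * (k l0 + 2 * eta).
  by rewrite subr_gt0; apply: le_lt_trans Gt; rewrite ler_pM2l//; move: eta0; lra.
have /cvgrPdist_lt/(_ _ Kl0)/nbhs_ballP[r1 /= r10 Hr1] := cK l0.
pose r := Num.min r1 (r0 / 2).
have r_gt0 : 0 < r by rewrite lt_min r10 divr_gt0.
pose phi := bump l0 r; have Cphi : C1 phi := C1_bump l0 r.
have Ccphi : Cc phi := Cc_bump l0 r_gt0.
have phi0 l : 0 <= phi l := bump_ge0 l0 r l.
have phiE l : r <= `|l - l0| -> phi l = 0 := bump_eq0 r_gt0.
pose m := leb phi; have m0 : 0 < m := leb_bump_gt0 l0 r_gt0.
pose phis s l := phi (l + (- s) *: w).
have Cps s : C1 (phis s) by exact: C1_shift.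
have Ccps s : Cc (phis s) by exact: (@Cc_shift (- s *: w)).
have leb_phis s : leb (phis s) = m by exact: leb_shift.
pose M := `|l0| + r + t * `|w|.
have M0 : 0 <= M by rewrite !addr_ge0 ?mulr_ge0 ?(ltW r_gt0) ?(ltW t0).
have phisM s l : 0 <= s <= t -> M < `|l| -> phis s l = 0.
  move=> /andP[s0 st] lM; apply: phiE.
  have := ler_normB (l - s *: w) (- (s *: w)); rewrite opprK subrK normrN.
  have := ler_normD (l - s *: w - l0) l0; rewrite subrK.
  have : `|s *: w| <= t * `|w| by rewrite normrZ ger0_norm// ler_wpM2r.
  by rewrite scaleNr; move: lM; rewrite /M; lra.
have phis_supp s l : 0 <= s <= t -> r0 <= `|l - l0| -> phis s l = 0.
  move=> /andP[s0 st] lr; apply: phiE.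
  have := ler_normD (l - s *: w - l0) (s *: w).
  rewrite (_ : l - s *: w - l0 + s *: w = l - l0); last by rewrite addrAC subrK.
  have : `|s *: w| <= t * `|w| by rewrite normrZ ger0_norm// ler_wpM2r.
  have : r <= r0 / 2 by rewrite ge_min lexx orbT.
  by rewrite scaleNr; move: tw lr; lra.
have [B B0 GB] := continuous_ball_bounded M cG.
have [M1 phiM1] := Ccphi.2.
have vol0 : 0 <= ball_vol M by apply: fine_ge0; exact: measure_ge0.
have Bv0 : 0 < B * ball_vol M + 1 by rewrite ltr_wpDl// mulr_ge0.
have [Phi PhiE] : exists Phi : R -> R, forall s, Phi s = leb (fun l => G l * phis s l).
  by eexists.
have CGp s : Cc (fun l => G l * phis s l) by exact: CcM.
have dps s l : 'D_w (phis s) l = 'D_w phi (l + (- s) *: w) by exact: derive_shift_arg.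
have CDps s : Cc ('D_w (phis s)).
  split; first by have [_] := Cps s; apply.
  by have [_ [M' HM']] := Ccps s; exists M'; exact: derive_supp.
have upper s : 0 <= s <= t -> leb (fun l => k l * phis s l) <= (k l0 + eta) * m.
  move=> sI; rewrite -(leb_phis s) -leb_scale//; apply: leb_le.
  - exact: CcM.
  - exact: CcZ.
  - move=> l; have [lr|lr] := ltP `|l - l0| r0; last first.
      by rewrite (phis_supp s l sI lr) !mulr0.
    apply: ler_wpM2r; first exact: phi0.
    have := Hr0 l; rewrite -ball_normE /= (distrC l0 l) => /(_ lr).
    by rewrite ltr_norml => /andP[+ _]; lra.
(* Translation by [t *: w] moves the shift from the bump to [G], so only values of [G] enter, never
   its derivative away from [l0]. *)
have lower : t * (k l0 + 2 * eta) * m <= Phi t - Phi 0.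
  have -> : Phi t - Phi 0 = leb (fun l => K l * phi l).
    have -> : Phi t = leb (fun l => G (l + t *: w) * phi l).
      rewrite PhiE -(leb_shift (t *: w) (CGp t)); congr leb.
      by apply/funext => l; rewrite /phis -addrA -scalerDl subrr scale0r addr0.
    rewrite PhiE -leb_sub//; last by apply: CcM => //; exact: continuous_shift_arg.
    congr leb; apply/funext => l.
    by rewrite /K /phis oppr0 scale0r addr0 mulrBl.
  rewrite /m -leb_scale//; apply: leb_le; [exact: CcZ|exact: CcM|move=> l].
  have [lr|lr] := ltP `|l - l0| r; last by rewrite (phiE l lr) !mulr0.
  apply: ler_wpM2r => //.
  have lr1 : `|l - l0| < r1 by apply: lt_le_trans lr _; rewrite ge_min lexx.
  have := Hr1 l; rewrite -ball_normE /= (distrC l0 l) => /(_ lr1).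
  by rewrite ltr_norml => /andP[_]; lra.
suff : Phi t - t * ((k l0 + eta) * m) <= Phi 0 - 0 * ((k l0 + eta) * m).
  move=> U; have : t * (k l0 + 2 * eta) * m <= t * ((k l0 + eta) * m).
    apply: le_trans lower _; move: U.
    by rewrite mul0r subr0 !lerBlDr [X in _ <= X -> _]addrC.
  by rewrite mulrA leNgt ltr_pM2r// ltr_pM2l// ltrD2l ltr_pMl// ltr1n.
apply: (@right_slope_le0 _ (fun s => Phi s - s * ((k l0 + eta) * m)) t (ltW t0)).
  move=> s sI e e0; set A := (k l0 + eta) * m.
  pose e1 := e / 2 / (B * ball_vol M + 1).
  have e10 : 0 < e1 by rewrite !divr_gt0.
  have [d1 d10 Hd1] := supp_unif_continuous (C1_continuous Cphi) phiM1 e10.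
  have A1 : 0 < `|A| + 1 by rewrite ltr_wpDl.
  have w1 : 0 < `|w| + 1 by rewrite ltr_wpDl.
  exists (Num.min (d1 / (`|w| + 1)) (e / 2 / (`|A| + 1))).
    by rewrite lt_min !divr_gt0.
  move=> q qI; rewrite lt_min !ltr_pdivlMr// => /andP[q1 q2].
  have P1 : `|Phi q - Phi s| <= e / 2.
    rewrite !PhiE -leb_sub//.
    have : `|leb (fun l => G l * phis q l - G l * phis s l)| <= B * e1 * ball_vol M.
      apply: leb_bound => //; first exact: CcB.
        by move=> l lM; rewrite (phisM q l qI lM) (phisM s l sI lM) !mulr0 subrr.
      move=> l; rewrite -mulrBr normrM; have [lM|lM] := leP `|l| M; last first.
        by rewrite (phisM q l qI lM) (phisM s l sI lM) subrr normr0 mulr0 mulr_ge0// ltW.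
      apply: ler_pM => //; first exact: GB.
      apply: Hd1; rewrite opprD addrACA subrr add0r -scaleNr -scalerDl normrZ opprK.
      rewrite addrC distrC; apply: le_lt_trans q1.
      by apply: ler_wpM2l => //; rewrite lerDl.
    move=> /le_trans; apply; rewrite mulrAC /e1 mulrA ler_pdivrMr//.
    by rewrite mulrC ler_pM2l ?divr_gt0// lerDl.
  have P2 : `|q * A - s * A| <= e / 2.
    rewrite -mulrBl normrM ler_pdivlMr//; apply: (le_trans _ (ltW q2)).
    rewrite ler_pM2r//.
    by apply: ler_wpM2l => //; rewrite lerDl.
  rewrite (_ : _ - _ = (Phi q - Phi s) - (q * A - s * A)); last by ring.
  by apply: le_trans (ler_normB _ _) _; rewrite [e]splitr lerD.
move=> s /andP[s0 st] e e0.
have e10 : 0 < e / (B * ball_vol M + 1) by rewrite divr_gt0.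
have [d1 d10 Hd1] := unif_taylor (fun l => C1_derivable Cphi) (Cphi.2 w) phiM1 e10.
exists (Num.min d1 (t - s)); first by rewrite lt_min d10 subr_gt0.
move=> dl /andP[dl0]; rewrite lt_min => /andP[dl1 dls].
have sI : 0 <= s <= t by rewrite s0 ltW.
have sdI : 0 <= s + dl <= t.
  by rewrite addr_ge0 ?(ltW dl0)//= -lerBrDl ltW.
have U := upper s sI.
(* The derivative of [phis s] in [s] is [- 'D_w (phis s)]; the weak equation tested on [phis s] thus
   turns the derivative of [Phi] into an integral of [k] against [phis s]. *)
have W : leb (fun l => G l * 'D_w (phis s) l) = - leb (fun l => k l * phis s l).
  apply/eqP; rewrite -addr_eq0 -[X in _ + X]mul1r -leb_linear; [|exact: CcM..].
  apply/eqP; rewrite -[RHS](weak (phis s) (Cps s) (Ccps s)); congr leb.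
  by apply/funext => l; rewrite mul1r.
have CD : Cc (fun l => G l * 'D_w (phis s) l) by exact: CcM.
have E : leb (fun l => (G l * phis (s + dl) l - G l * phis s l) +
      dl * (G l * 'D_w (phis s) l)) =
    Phi (s + dl) - Phi s - dl * leb (fun l => k l * phis s l).
  rewrite leb_linear//; last exact: CcB.
  by rewrite leb_sub// W mulrN !PhiE.
have : `|leb (fun l => (G l * phis (s + dl) l - G l * phis s l) +
      dl * (G l * 'D_w (phis s) l))| <= B * (e / (B * ball_vol M + 1) * dl) * ball_vol M.
  apply: leb_bound => //.
  - by apply: CcD; [exact: CcB|exact: CcZ].
  - move=> l lM; rewrite (phisM _ l sdI lM) (phisM s l sI lM) !mulr0 subrr add0r.
    rewrite dps; have := @derive_supp _ _ (phis s) w M (fun l => phisM s l sI) l lM.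
    by rewrite dps => ->; rewrite !mulr0.
  - move=> l; have [lM|lM] := leP `|l| M; last first.
      rewrite (phisM _ l sdI lM) (phisM s l sI lM) !mulr0 subrr add0r.
      rewrite (@derive_supp _ _ (phis s) w M (fun l => phisM s l sI) l lM).
      rewrite !mulr0 normr0.
      exact: mulr_ge0 B0 (mulr_ge0 (ltW e10) (ltW dl0)).
    rewrite (_ : _ + _ = G l * (phis (s + dl) l - phis s l + dl * 'D_w (phis s) l)); last by ring.
    rewrite normrM; apply: ler_pM => //; first exact: GB.
    have := Hd1 (- dl) (l + (- s) *: w); rewrite normrN (gtr0_norm dl0) => /(_ dl1).
    have -> : phis (s + dl) l = phi (l + (- s) *: w + (- dl) *: w).
      by rewrite /phis opprD scalerDl addrA.
    by rewrite dps mulNr opprK.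
rewrite E => /(le_trans (ler_norm _)) H.
have : B * (e / (B * ball_vol M + 1) * dl) * ball_vol M <= e * dl.
  rewrite (_ : _ * _ = (B * ball_vol M) * (e * dl) / (B * ball_vol M + 1)); last by ring.
  by rewrite ler_pdivrMr// mulrC ler_pM2l ?mulr_gt0// lerDl.
have : dl * leb (fun l => k l * phis s l) <= dl * ((k l0 + eta) * m) by rewrite ler_pM2l.
by move: H; rewrite mulrDl; lra.
Qed.

(** The hypotheses are stable under changing the signs of [G] and [k], which turns one inequality
    into the other. *)
Lemma weak_derive w (G k : 'rV[R]_d -> R) l0 : continuous G -> continuous k ->
  derivable G l0 w ->
  (forall phi, C1 phi -> Cc phi -> leb (fun l => G l * 'D_w phi l + k l * phi l) = 0) ->
  'D_w G l0 = k l0.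
Proof.
move=> cG ck dG weak; apply/eqP; rewrite eq_le weak_derive_le//=.
rewrite -lerN2 -(deriveN dG).
apply: (@weak_derive_le w (fun l => - G l) (fun l => - k l)); [exact: ctsN|exact: ctsN|exact: derivableN|].
move=> phi Cphi Ccphi.
rewrite (_ : (fun l => _) = fun l => (-1) * (G l * 'D_w phi l + k l * phi l)).
  rewrite leb_scale ?weak ?mulr0//; apply: CcD; last exact: CcM.
  apply: (CcM cG); split; first by have [_] := Cphi; apply.
  by have [_ [M HM]] := Ccphi; exists M; exact: derive_supp.
by apply/funext => l; ring.
Qed.

End Cc_integral.
(** * The stationary equation *)

Lemma cvg_sumn (R : realType) (I : Type) (r : seq I) (F : I -> nat -> R) (l : I -> R) :
  (forall i, F i n @[n --> \oo] --> l i) ->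
  \sum_(i <- r) F i n @[n --> \oo] --> \sum_(i <- r) l i.
Proof.
move=> Fl; elim: r => [|i r IH].
  by under eq_fun do rewrite big_nil; rewrite big_nil; exact: cvg_cst.
by under eq_fun do rewrite big_cons; rewrite big_cons; exact: cvgD.
Qed.

Section stationary.
Variables (R : realType) (N d : nat).
Variable mu : {sigma_finite_measure set (Rd R d) -> \bar R}.
Hypothesis hmu : is_lebesgue_Rd mu.
Variables (v : 'I_N -> 'rV[R]_d) (a : 'I_N -> 'I_N -> 'rV[R]_d -> R).
Hypothesis hac : forall i j, i != j -> continuous (a i j).
Variable P : trans_fun R N d.
Hypothesis hP : is_process_semigroup v a P.
Variable p : 'I_N -> R.
Hypotheses (hp0 : forall j, 0 < p j) (hp1 : \sum_(j < N) p j = 1).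
Variable g : 'rV[R]_d -> R.
Hypotheses (hg0 : forall l, 0 <= g l) (hgd : forall l, differentiable g l).
Hypothesis hg1 : leb_int (fun l => (g l)%:E) = 1%E.
Implicit Types (i j : 'I_N) (l : 'rV[R]_d) (f h : 'I_N -> 'rV[R]_d -> R).

Let cg : continuous g.
Proof. by move=> l; exact: differentiable_continuous. Qed.

Let mg : measurable_fun [set: Rd R d] (g : Rd R d -> R).
Proof. exact: continuous_measurable_Rd. Qed.

Let g_integral : (\int[mu]_x (g x)%:E)%E = 1%E.
Proof.
have [intE _ _] := hmu; by rewrite -hg1 intE//; exact/measurable_EFinP.
Qed.

Let g_integrable : mu.-integrable setT (EFin \o (g : Rd R d -> R)).
Proof.
apply/integrableP; split; first exact/measurable_EFinP.
under eq_integral do rewrite /= ger0_norm//.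
by rewrite g_integral ltry.
Qed.

Lemma density_integrable (u : Rd R d -> R) : mbounded u ->
  mu.-integrable setT (EFin \o (fun l : Rd R d => g l * u l)).
Proof.
move=> [mu' [M uM]].
have iM : mu.-integrable setT (fun l : Rd R d => (M%:E * (g l)%:E)%E).
  exact: integrableZl.
apply: le_integrable iM => //; first by apply/measurable_EFinP; exact: measurable_funM.
move=> l _; rewrite /= lee_fin normrM mulrC.
by rewrite [leRHS]ger0_norm ?(ger0_norm (hg0 l)) ?mulr_ge0 ?ler_wpM2r// (le_trans _ (uM l)).
Qed.

(** Integration against [pi]; it takes the role of the abstract functional [Pi]. *)
Definition stat f : R := \sum_(j < N) p j * leb mu (fun l => g l * f j l).

Lemma stat_linear f h c : mbstate f -> mbstate h ->
  stat (fun i l => f i l + c * h i l) = stat f + c * stat h.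
Proof.
move=> mf mh; rewrite /stat mulr_sumr -big_split/=; apply: eq_bigr => j _.
have If := density_integrable (mf j); have Ih := density_integrable (mh j).
have Ich := density_integrable (mboundedZ c (mh j)).
rewrite mulrCA -mulrDr; congr (_ * _); rewrite /leb -(RintegralZl c measurableT Ih).
have E : (fun l => c * (g l * h j l)) = fun l => g l * (c * h j l).
  by apply/funext => l; rewrite mulrCA.
rewrite E -(RintegralD measurableT If Ich); congr (Rintegral mu setT _).
by apply/funext => l; rewrite mulrDr.
Qed.

Lemma stat_bound f (M : R) : mbstate f -> (forall i l, `|f i l| <= M) ->
  `|stat f| <= M.
Proof.
move=> mf fM; rewrite /stat -[M]mul1r -hp1 mulr_suml.
apply: le_trans (ler_norm_sum _ _ _) _; apply: ler_sum => j _.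
rewrite normrM (gtr0_norm (hp0 j)) ler_pM2l//.
have If := density_integrable (mf j).
have -> : M = Rintegral mu setT (fun l : Rd R d => M * g l).
  by rewrite RintegralZl// /Rintegral g_integral mulr1.
apply: le_trans; first exact: le_normr_Rintegral.
apply: le_Rintegral => //; first by move/integrable_abse : If.
  exact: (@integrableZl _ _ _ mu setT measurableT M _ g_integrable).
by move=> l _; rewrite normrM (ger0_norm (hg0 l)) mulrC ler_wpM2r.
Qed.

Lemma stat_cvg (F : nat -> 'I_N -> 'rV[R]_d -> R) f (M : R) :
  (forall n, mbstate (F n)) -> mbstate f -> (forall n i l, `|F n i l| <= M) ->
  (forall i l, F n i l @[n --> \oo] --> f i l) ->
  stat (F n) @[n --> \oo] --> stat f.
Proof.
move=> mF mf FM Ff; rewrite /stat; apply: cvg_sumn => j.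
apply: cvgM; first exact: cvg_cst.
apply: (@Rintegral_dominated_cvg _ _ _ mu _ _ (fun l : Rd R d => M * g l)).
- by move=> n; apply: measurable_funM => //; have [] := mF n j.
- by apply: measurable_funM => //; have [] := mf j.
- exact: (@integrableZl _ _ _ mu setT measurableT M _ g_integrable).
- by move=> n l; rewrite normrM (ger0_norm (hg0 l)) mulrC ler_wpM2r.
- by move=> l; apply: cvgM; [exact: cvg_cst|exact: Ff].
Qed.

Lemma semigroup_cvg t (F : nat -> 'I_N -> 'rV[R]_d -> R) f (M : R) : 0 <= t ->
  (forall n, mbstate (F n)) -> mbstate f -> (forall n i l, `|F n i l| <= M) ->
  (forall i l, F n i l @[n --> \oo] --> f i l) ->
  forall j l, semigroup P t (F n) j l @[n --> \oo] --> semigroup P t f j l.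
Proof.
move=> t0 mF mf FM Ff j l; rewrite /semigroup; apply: cvg_sumn => i.
apply: (@Rintegral_dominated_cvg _ _ _ _ _ _ (cst M)).
- by move=> n; have [] := mF n i.
- by have [] := mf i.
- by apply: (kernel_integrable hP) => //; exact: mbounded_cst.
- by move=> n x; exact: FM.
- exact: Ff.
Qed.

Lemma defect_cvg t (F : nat -> 'I_N -> 'rV[R]_d -> R) f (M : R) : 0 <= t ->
  (forall n, mbstate (F n)) -> mbstate f -> (forall n i l, `|F n i l| <= M) ->
  (forall i l, F n i l @[n --> \oo] --> f i l) ->
  defect P stat t (F n) @[n --> \oo] --> defect P stat t f.
Proof.
move=> t0 mF mf FM Ff; rewrite /defect; apply: cvgB; last exact: stat_cvg FM Ff.
apply: (@stat_cvg _ _ M).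
- by move=> n; exact: (mbstate_semigroup hP).
- exact: (mbstate_semigroup hP).
- by move=> n; apply: (semigroup_bound hP) => //; exact: FM.
- exact: semigroup_cvg FM Ff.
Qed.

Lemma leb_int_density (c : R) (u : Rd R d -> R) (w : Rd R d -> \bar R) : 0 <= c -> mbounded u ->
  (forall l, w l = (u l)%:E) -> (forall l, 0 <= u l) ->
  leb_int (fun l => ((c * g l)%:E * w l)%E) = (c * leb mu (fun l => g l * u l))%:E.
Proof.
move=> c0 mu' wu u0; have [intE _ _] := hmu.
have Iu := density_integrable mu'.
rewrite (_ : (fun l => _) = (fun l : Rd R d => (c * (g l * u l))%:E)); last first.
  by apply/funext => l; rewrite wu -EFinM mulrA.
rewrite intE; last 2 first.
- apply/measurable_EFinP; apply: measurable_funM => //; apply: measurable_funM => //.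
  by have [] := mu'.
- by move=> l; rewrite lee_fin !mulr_ge0.
rewrite /leb -(RintegralZl c measurableT Iu) /Rintegral fineK//.
apply: integrable_fin_num => //.
exact: (@integrableZl _ _ _ mu setT measurableT c _ Iu).
Qed.

(** Both sides of the invariance identity are values of [stat]: on [P_t] applied to the indicator of
    [{i} x B], and on that indicator itself. *)
Lemma invariant_densityP : invariant_density P (fun j l => p j * g l) <->
  forall t i (B : set (Rd R d)), 0 <= t -> measurable B ->
    defect P stat t (at_state i \1_B) = 0.
Proof.
have key t i (B : set (Rd R d)) : 0 <= t -> measurable B ->
    ((\sum_(j < N) leb_int (fun l => (p j * g l)%:E * P t j l i B))%E =
      (stat (semigroup P t (at_state i \1_B)))%:E) /\
    (leb_int (fun l => ((p i * g l)%:E * (\1_B l)%:E)%E) =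
      (stat (at_state i \1_B))%:E).
  move=> t0 mB; split.
    rewrite /stat -sumEFin; apply: eq_bigr => j _.
    have QE : semigroup P t (at_state i \1_B) j = fun l => fine (P t j l i B).
      apply/funext => l; rewrite /semigroup (bigD1 i)//= big1 ?addr0 => [|k ki].
        rewrite -(Rintegral_indic_kernel P t j l i mB); congr (Rintegral _ _ _).
        by apply/funext => x; rewrite /at_state eqxx.
      rewrite (_ : at_state i \1_B k = cst 0); first by rewrite Rintegral_cst// mul0r.
      by apply/funext => x; rewrite /at_state (negbTE ki).
    rewrite QE; apply: leb_int_density => //.
    - exact: ltW.
    - have := mbstate_semigroup hP t0 (mbstate_at i (mbounded_indic R mB)) j.
      by rewrite QE.
    - by move=> l; rewrite fineK// (kernel_fin hP).
  rewrite /stat (bigD1 i)//= big1 ?addr0 => [|k ki].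
    rewrite (_ : at_state i \1_B i = \1_B); last first.
      by apply/funext => x; rewrite /at_state eqxx.
    apply: leb_int_density => //; first exact: ltW.
    exact: mbounded_indic.
  rewrite (_ : (fun l => _) = cst 0) ?/leb ?Rintegral_cst ?mul0r ?mulr0//.
  by apply/funext => x; rewrite /at_state (negbTE ki) mulr0.
split=> [inv t i B t0 mB|D0 t t0 i B mB].
  have [E1 E2] := key t i B t0 mB; apply/eqP; rewrite subr_eq0; apply/eqP.
  by apply: EFin_inj; rewrite -E1 -E2; exact: inv.
have [E1 E2] := key t i B t0 mB.
apply: etrans E1 _; apply: etrans (esym E2); congr EFin.
by apply/eqP; rewrite -subr_eq0; apply/eqP; exact: D0.
Qed.

Lemma invariant_weak : invariant_density P (fun j l => p j * g l) <->
  forall f, test_fun f -> stat (generator v a f) = 0.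
Proof.
have Dlin (t : R) (t0 : 0 <= t) f h (c : R) : mbstate f -> mbstate h ->
    defect P stat t (fun i l => f i l + c * h i l) =
    defect P stat t f + c * defect P stat t h.
  exact: (defect_linear hP stat_linear).
split=> [/invariant_densityP inv|W].
  apply: (invariant_generator hP hac stat_linear stat_bound) => t f t0 tf.
  apply/eqP; rewrite -subr_eq0 -/(defect P stat t f); apply/eqP.
  apply: (@zero_mbstate _ _ _ (defect P stat t) (Dlin t t0) (fun F f M => @defect_cvg t F f M t0)).
    by move=> i B; exact: inv.
  exact: test_fun_mbstate.
apply/invariant_densityP => t i B t0 mB.
apply: (@zero_measurable _ _ _ (defect P stat t) (Dlin t t0) (fun F f M => @defect_cvg t F f M t0)) => // f tf.
by rewrite /defect (invariant_test hP hac stat_linear stat_bound W t0 tf) subrr.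
Qed.

(** The net flow of probability into state [j], that is, the adjoint of the jump part applied to the
    density. *)
Definition net_flux j l : R :=
  \sum_(i < N | i != j) (p i * a i j l * g l - p j * a j i l * g l).

Lemma net_flux_continuous j : continuous (net_flux j).
Proof.
apply: cts_sum => i ij; apply: ctsB; apply: ctsM => //; apply: ctsM;
  try exact: cst_continuous; apply: hac => //.
by rewrite eq_sym.
Qed.

(** Exchanging [i] and [j] in the gain terms of the double sum moves the jump part from [f] to the
    density. *)
Lemma generator_net_flux f l :
  \sum_(j < N) p j * (g l * generator v a f j l) =
  \sum_(j < N) (p j * g l * 'D_(v j) (f j) l + net_flux j l * f j l).
Proof.
pose X j i := p j * g l * a j i l.
have E : \sum_(j < N) \sum_(i < N | i != j) X j i * f i l =
    \sum_(j < N) \sum_(i < N | i != j) X i j * f j l.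
  rewrite (exchange_big_dep predT)//=; apply: eq_bigr => i _.
  by apply: eq_bigl => j; rewrite eq_sym.
transitivity (\sum_(j < N) (p j * g l * 'D_(v j) (f j) l +
    (\sum_(i < N | i != j) X j i * f i l - \sum_(i < N | i != j) X j i * f j l))).
  apply: eq_bigr => j _; rewrite /generator mulrA mulrDr; congr (_ + _).
  rewrite mulr_sumr -sumrB; apply: eq_bigr => i _.
  by rewrite mulrA -/(X j i) mulrBr.
rewrite big_split [RHS]big_split/=; congr (_ + _).
rewrite sumrB E -sumrB; apply: eq_bigr => j _.
rewrite -sumrB /net_flux mulr_suml; apply: eq_bigr => i _.
by rewrite /X; ring.
Qed.

Lemma leb_sum (F : 'I_N -> 'rV[R]_d -> R) : (forall j, Cc (F j)) ->
  leb mu (fun l => \sum_(j < N) F j l) = \sum_(j < N) leb mu (F j).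
Proof.
move=> CF.
suff [_] : Cc (fun l => \sum_(j < N) F j l) /\
  leb mu (fun l => \sum_(j < N) F j l) = \sum_(j < N) leb mu (F j) by [].
elim: (index_enum 'I_N) => [|j r [IC IH]].
  rewrite big_nil; under eq_fun do rewrite big_nil.
  split; first by split; [exact: cst_continuous|exists 0].
  by rewrite /leb Rintegral_cst// mul0r.
rewrite big_cons -IH.
have -> : (fun l => \sum_(i <- j :: r) F i l) =
    fun l => F j l + 1 * \sum_(i <- r) F i l.
  by apply/funext => l; rewrite big_cons mul1r.
split; first by apply: CcD => //; exact: CcZ.
by rewrite leb_linear// mul1r.
Qed.

Lemma stat_generator f : test_fun f -> stat (generator v a f) =
  \sum_(j < N) leb mu (fun l => p j * g l * 'D_(v j) (f j) l + net_flux j l * f j l).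
Proof.
move=> tf; have [cG [M GM]] := generator_Cc v hac tf.
have [cT [K TK]] := transport_Cc v tf.
have [cf [L fL]] := test_fun_Cc tf.
have Cgen j : Cc (generator v a f j) by split=> //; exists M; exact: GM.
rewrite -leb_sum => [|j]; last first.
  apply: CcD; apply: CcM.
  - by apply: ctsM => //; exact: cst_continuous.
  - by split=> //; exists K; exact: TK.
  - exact: net_flux_continuous.
  - by split=> //; exists L; exact: fL.
transitivity (leb mu (fun l => \sum_(j < N) p j * (g l * generator v a f j l))).
  rewrite leb_sum => [|j]; last by apply: CcZ; exact: CcM.
  by apply: eq_bigr => j _; rewrite leb_scale//; exact: CcM.
by congr leb; apply/funext => l; exact: generator_net_flux.
Qed.

Lemma weak_pde : (forall f, test_fun f -> stat (generator v a f) = 0) <->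
  forall j l, - (p j * 'D_(v j) g l) + net_flux j l = 0.
Proof.
have dg l w : derivable g l w by exact: diff_derivable.
split=> [W j l|pde f tf].
  suff : 'D_(v j) (fun l => p j * g l) l = net_flux j l.
    have -> : (fun l => p j * g l) = p j *: g by [].
    by rewrite deriveZ// => <-; rewrite addNr.
  apply: (weak_derive hmu).
  - by apply: ctsM => //; exact: cst_continuous.
  - exact: net_flux_continuous.
  - exact: derivableZ.
  - move=> phi Cphi [cphi [M phiM]].
    (* A test function carried by state [j] alone isolates the equation of index [j]. *)
    have tf : test_fun (at_state j phi).
      apply/test_funP; split=> [k|].
        by rewrite /at_state; case: eqP => _; [exact: Cphi|exact: C1_cst].
      by exists M => k x xM; rewrite /at_state; case: eqP => // _; exact: phiM.
    have := W _ tf; rewrite (stat_generator tf) (bigD1 j)//= big1 ?addr0 => [|k kj].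
      by rewrite (_ : at_state j phi j = phi)//; apply/funext => x; rewrite /at_state eqxx.
    rewrite (_ : at_state j phi k = cst 0); last first.
      by apply/funext => x; rewrite /at_state (negbTE kj).
    under eq_fun do rewrite derive_cst !mulr0 addr0.
    by rewrite /leb Rintegral_cst// mul0r.
have [Cf [M fM]] := (test_funP f).1 tf.
rewrite (stat_generator tf) big1// => j _.
have pD l : p j * 'D_(v j) g l = net_flux j l.
  by apply/eqP; rewrite eq_sym -subr_eq0 addrC; apply/eqP; exact: pde.
(* The equation itself supplies the missing regularity: it equates [p j * 'D_(v j) g] with the
   continuous [net_flux j], and [p j] is positive. *)
have cDg : continuous ('D_(v j) g).
  have -> : 'D_(v j) g = fun l => (p j)^-1 * net_flux j l.
    by apply/funext => l; rewrite -pD mulKf// gt_eqF.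
  by apply: ctsM; [exact: cst_continuous|exact: net_flux_continuous].
(* By the product rule and the equation, the integrand is [p j] times the derivative of [g * f j]
   along [v j], whose integral vanishes. *)
pose h l := g l * f j l.
have dh l : derivable h l (v j) by apply: derivableM => //; exact: C1_derivable.
have hE l : 'D_(v j) h l = g l * 'D_(v j) (f j) l + f j l * 'D_(v j) g l.
  by rewrite deriveM//; exact: C1_derivable.
have cDh : continuous ('D_(v j) h).
  rewrite (_ : 'D_(v j) h = fun l => g l * 'D_(v j) (f j) l + f j l * 'D_(v j) g l).
    exact: (ctsD (ctsM cg ((Cf j).2 (v j))) (ctsM (C1_continuous (Cf j)) cDg)).
  by apply/funext => l; exact: hE.
have Ch : Cc h.
  by apply: CcM => //; split; [exact: C1_continuous|exists M; exact: fM].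
have -> : (fun l => p j * g l * 'D_(v j) (f j) l + net_flux j l * f j l) =
    fun l => p j * 'D_(v j) h l.
  by apply/funext => l; rewrite hE -pD; ring.
have CD : Cc ('D_(v j) h).
  by split=> //; have [_ [K hK]] := Ch; exists K; exact: derive_supp.
by rewrite leb_scale// leb_derive// mulr0.
Qed.

End stationary.

Unset Implicit Arguments.

Theorem theorem2p1 (R : realType) (N d : nat) (hN : (1 < N)%N) (hd : (0 < d)%N)
  (v : 'I_N -> 'rV[R]_d) (hv0 : exists j, v j != 0)
  (hspan : \rank (\matrix_(j < N) v j) = d)
  (a : 'I_N -> 'I_N -> 'rV[R]_d -> R)
  (ha0 : forall i j l, i != j -> 0 <= a i j l)
  (hac : forall i j, i != j -> continuous (a i j))
  (P : trans_fun R N d) (hP : is_process_semigroup v a P)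
  (hH : harris_irreducible P)
  (p : 'I_N -> R) (hp0 : forall j, 0 < p j) (hp1 : \sum_(j < N) p j = 1)
  (g : 'rV[R]_d -> R) (hg0 : forall l, 0 <= g l)
  (hgd : forall l, differentiable g l)
  (hg1 : leb_int (fun l => (g l)%:E) = 1%E) :
  invariant_density P (fun j l => p j * g l) <->
  (forall j l, - (p j * 'D_(v j) g l)
     + \sum_(i < N | i != j) (p i * a i j l * g l - p j * a j i l * g l) = 0).
Proof.
have [mu hmu] := lebesgue_Rd_exists R d.
apply: iff_trans (invariant_weak hmu hac hP hp0 hp1 hg0 hgd hg1) _.
exact: (weak_pde hmu v hac hp0 hgd).
Qed.
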